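(* Let $n$ and $m$ be integers with $0\le m\le 2n-5$. There are $n$ people $v_1,\dots,v_n$, each of whom initially knows exactly one item of gossip (her own), all items distinct. A call is an unordered pair of two distinct people; during a call, each of the two participants learns every item known by the other, so that afterwards both know the union of what they knew before. For a sequence of $m$ calls, let $N$ be the total number of items known after all $m$ calls, i.e. $N=\sum_{j=1}^n(\text{number of items known by }v_j)$. Consider the following sequence of $2n-3$ calls: $\{v_2,v_1\},\{v_3,v_1\},\dots,\{v_n,v_1\}$, followed by $\{v_1,v_2\},\{v_1,v_3\},\dots,\{v_1,v_{n-1}\}$. Then the first $m$ calls of this sequence achieve the maximum possible value of $N$ over all sequences of $m$ calls among the $n$ people.
   Context: Calls happen one after another in the given order. Each person's knowledge is a set of gossip items; initially person $v_j$ knows only her own item, and a call between two people replaces each participant's knowledge set by the union of the two knowledge sets. *)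

(* Defs.v *)
From mathcomp Require Import all_boot.

Set Implicit Arguments.
Unset Strict Implicit.
Unset Printing Implicit Defensive.

(* The person v_j (1 <= j <= n) is the ordinal i : 'I_n with i.+1 = j, and
   each item of gossip is identified with the person who initially knows it. *)

Definition is_call (n : nat) (c : {set 'I_n}) : bool := #|c| == 2.

Definition knowledge (n : nat) : Type := 'I_n -> {set 'I_n}.

Definition init_knowledge (n : nat) : knowledge n := fun v => [set v].

Definition make_call (n : nat) (K : knowledge n) (c : {set 'I_n}) :
    knowledge n :=
  fun v => if v \in c then \bigcup_(u in c) K u else K v.

Definition final_knowledge (n : nat) (s : seq {set 'I_n}) : knowledge n :=
  foldl (@make_call n) (@init_knowledge n) s.

Definition total_known (n : nat) (s : seq {set 'I_n}) : nat :=
  \sum_(v < n) #|final_knowledge s v|.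

Definition call_sequence (n m : nat) (s : seq {set 'I_n}) : bool :=
  (size s == m) && all (@is_call n) s.

(* The unordered pair {v_a, v_b}, for 1 <= a, b <= n. *)
Definition vpair (n a b : nat) : {set 'I_n} :=
  [set i : 'I_n | (i.+1 == a) || (i.+1 == b)].

Definition star_calls (n : nat) : seq {set 'I_n} :=
  [seq vpair n j 1 | j <- index_iota 2 n.+1] ++
  [seq vpair n 1 j | j <- index_iota 2 n].

(* Main.v *)
Require Import Defs.
From mathcomp Require Import all_boot zify.

(* For n people and m calls write D for the number of ordered pairs (x, z) such
   that z never learns the item of x, and r := 2n - 3 - m. The k-th call adds at
   most k + 1 known items, because its two participants together know at most
   k + 1 of them; for m <= n - 1 the star attains this bound. For m >= n - 1 the
   star has D = r (r + 1) / 2, and this is optimal by induction on n.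

   If somebody hears her own item, she can be deleted together with two calls,
   somebody else on the path of her item playing her role: r does not change.
   Otherwise, for each person x, call a call O-useful if it tells the item of x
   to one of its participants, and I-useful if it is the last step at which one
   of them can still send news to x. Only the calls of x herself are both, so the
   number of missing pairs involving x is 2n - 2 - m - deg x + U(x), where U(x)
   counts the calls useless for x. Summing over x settles r >= 3.

   For r = 2, i.e. m = 2n - 5, suppose D <= 2. Nobody has one call, and deleting
   a person with two calls contradicts the induction hypothesis, so everybody
   has at least three calls. Then U(x) = 0 for some x. A person whose first
   (last) call is not the first (last) call of her partner is the start (end) of
   a missing pair, hence at most n - 5 + D calls are neither first for both
   participants nor last for both; on the other hand U(x) = 0 forces at least
   n - 3 such calls, and one more when D = 2. *)

Set Implicit Arguments.
Unset Strict Implicit.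
Unset Printing Implicit Defensive.

(** * Spreading of an item *)

Section Spread.
Variable T : finType.
Implicit Types (A B c V : {set T}) (s : seq {set T}) (x z v : T).

(** [A] is the set of holders of one fixed item. Following single items rather than knowledge sets
    turns time reversal into a plain duality. *)
Definition step A c := if [disjoint A & c] then A else A :|: c.
Definition spread s A := foldl step A s.

Lemma disjointUl A B c :
  [disjoint A :|: B & c] = [disjoint A & c] && [disjoint B & c].
Proof. by rewrite -!setI_eq0 setIUl setU_eq0. Qed.

Lemma meetP A B : reflect (exists2 y, y \in A & y \in B) (~~ [disjoint A & B]).
Proof.
rewrite -setI_eq0; apply: (iffP (set0Pn _)) => [[y]|[y yA yB]].
  by rewrite inE => /andP[]; exists y.
by exists y; rewrite inE yA.
Qed.

Lemma in_step z A c :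
  (z \in step A c) = (z \in A) || (z \in c) && ~~ [disjoint A & c].
Proof. by rewrite /step; case: ifP => _; rewrite ?inE ?andbF ?orbF ?andbT. Qed.

Lemma spread_cat s1 s2 A : spread (s1 ++ s2) A = spread s2 (spread s1 A).
Proof. exact: foldl_cat. Qed.

Lemma spread_rcons s c A : spread (rcons s c) A = step (spread s A) c.
Proof. by rewrite -cats1 spread_cat. Qed.

Lemma stepU A B c : step (A :|: B) c = step A c :|: step B c.
Proof.
apply/setP=> z; rewrite !(in_step, inE) disjointUl.
by case: (z \in A); case: (z \in B); case: (z \in c);
  case: [disjoint A & c]; case: [disjoint B & c].
Qed.

Lemma spreadU s A B : spread s (A :|: B) = spread s A :|: spread s B.
Proof. by elim: s A B => //= c s IHs A B; rewrite stepU IHs. Qed.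

Lemma spreadS s A B : A \subset B -> spread s A \subset spread s B.
Proof. by move/setUidPr <-; rewrite spreadU subsetUl. Qed.

Lemma sub_spread s A : A \subset spread s A.
Proof.
elim: s A => //= c s IHs A; apply: subset_trans (IHs _).
by apply/subsetP=> z; rewrite in_step => ->.
Qed.

Lemma spread_self s x : x \in spread s [set x].
Proof. by apply: (subsetP (sub_spread s _)); rewrite inE. Qed.

Lemma spread_sub V s A :
  all (fun c : {set T} => c \subset V) s -> A \subset V -> spread s A \subset V.
Proof.
elim: s A => //= c s IHs A /andP[cV sV] AV; apply: IHs => //.
by rewrite /step; case: ifP; rewrite ?subUset ?AV.
Qed.

(** A chain of calls from [A] to [B] read backwards is a chain from [B] to [A]; it is enough to
    check this for one call. *)
Lemma spread_dual s A B :
  [disjoint spread s A & B] = [disjoint A & spread (rev s) B].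
Proof.
have step_dual A' B' c : [disjoint step A' c & B'] = [disjoint A' & step B' c].
  rewrite /step; case: ifPn => Ac; case: ifPn => Bc //.
  - by rewrite disjoint_sym [RHS]disjoint_sym disjointUl [[disjoint c & A']]disjoint_sym Ac andbT.
  - by rewrite disjointUl [[disjoint c & B']]disjoint_sym Bc andbT.
  rewrite disjointUl [RHS]disjoint_sym disjointUl [[disjoint c & B']]disjoint_sym (negbTE Bc).
  by rewrite [[disjoint c & A']]disjoint_sym (negbTE Ac) !andbF.
elim: s A B => //= c s IHs A B.
by rewrite rev_cons spread_rcons -step_dual IHs.
Qed.

Lemma in_spread_rev s x z :
  (z \in spread s [set x]) = (x \in spread (rev s) [set z]).
Proof.
by apply: negb_inj; rewrite -!disjoints1 -spread_dual disjoint_sym.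
Qed.

Lemma card_step A c : #|c| = 2 -> #|step A c| <= #|A| + ~~ [disjoint A & c].
Proof.
move=> c2; rewrite /step; case: ifPn => [_|]; first by rewrite addn0.
rewrite -setI_eq0 -cards_eq0 => Ac.
by have := cardsUI A c; rewrite c2 /=; lia.
Qed.

Lemma card_spread s A :
  all (fun c : {set T} => #|c| == 2) s -> #|spread s A| <= #|A| + size s.
Proof.
elim: s A => [|c s IHs] A /=; first by rewrite addn0.
case/andP=> /eqP c2 s2; have := IHs (step A c) s2.
by have := card_step A c2; case: [disjoint _ & _]; lia.
Qed.

Definition tot V s := \sum_(x in V) #|spread s [set x]|.

(** A call gives at most one new holder to an item, and only to items that reach it. By
    [spread_dual] the items reaching [c] after [s] are members of [spread (rev s) c], which has at
    most [2 + size s] elements. *)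
Lemma tot_le_quadratic V s :
  all (fun c : {set T} => #|c| == 2) s ->
  2 * tot V s <= 2 * #|V| + size s * (size s + 3).
Proof.
elim/last_ind: s => [_|s c IHs].
  rewrite /tot (eq_bigr (fun=> 1)) => [|x _]; last exact: cards1.
  by rewrite sum1_card /=; lia.
rewrite all_rcons size_rcons => /andP[/eqP c2 s2].
suff : tot V (rcons s c) <= tot V s + (2 + size s) by have := IHs s2; lia.
have le1 : tot V (rcons s c) <=
    \sum_(x in V) (#|spread s [set x]| + ~~ [disjoint spread s [set x] & c]).
  by apply: leq_sum => x _; rewrite spread_rcons card_step.
apply: leq_trans le1 _; rewrite big_split leq_add2l /=.
have s2' : all (fun c : {set T} => #|c| == 2) (rev s) by rewrite all_rev.
have := card_spread c s2'; rewrite c2 size_rev; apply: leq_trans.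
rewrite -sum1_card [leqLHS]big_mkcond [leqRHS]big_mkcond /=.
apply: leq_sum => x _; case: ifP => // _.
by rewrite spread_dual disjoints1 negbK; case: (x \in _).
Qed.

Definition calls V s := all (fun c : {set T} => (#|c| == 2) && (c \subset V)) s.

Lemma calls_card2 V s : calls V s -> all (fun c : {set T} => #|c| == 2) s.
Proof. by apply: sub_all => c /andP[]. Qed.

Lemma calls_sub V s : calls V s -> all (fun c : {set T} => c \subset V) s.
Proof. by apply: sub_all => c /andP[]. Qed.

Lemma calls_spread V s x : calls V s -> x \in V -> spread s [set x] \subset V.
Proof. by move/calls_sub=> sV xV; apply: spread_sub; rewrite ?sub1set. Qed.

Lemma spread_avoid s A v :
  all (fun c : {set T} => v \notin c) s -> (v \in spread s A) = (v \in A).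
Proof.
elim: s A => //= c s IHs A /andP[vc vs].
by rewrite IHs // in_step (negbTE vc) orbF.
Qed.

Lemma spread_enter s A x : x \in spread s A -> x \notin A ->
  exists u c w p, [/\ s = u ++ c :: w, x \in c, p \in c, p != x & p \in spread u A].
Proof.
elim/last_ind: s => [|s c IHs]; first by move=> /= ->.
rewrite spread_rcons in_step => xs xA.
have [/IHs/(_ xA)[u [c' [w [p [-> ? ? ? ?]]]]]|nxs] := boolP (x \in spread s A).
  by exists u, c', (rcons w c), p; split; rewrite ?rcons_cat.
move: xs; rewrite (negbTE nxs) /= => /andP[xc /meetP[p ps pc]].
exists s, c, [::], p; split; rewrite ?cats1 //.
by apply: contraNneq nxs => <-.
Qed.

End Spread.

(** * Deleting a person who hears her own item *)

Section Substitution.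
Variable T : finType.
Implicit Types (A B c V : {set T}) (s : seq {set T}) (x z v b : T).

Definition stand_in v b z := if z == v then b else z.

(** [s'] simulates [s] with [v] deleted, [b] holding at the end all that [v] held. The item of [v]
    itself is disregarded. *)
Definition dominates v b s s' := forall x, x != v ->
  forall z, z \in spread s [set x] -> stand_in v b z \in spread s' [set x].

Lemma stand_in_neq v b z : b != v -> stand_in v b z != v.
Proof. by rewrite /stand_in; case: ifPn. Qed.

(** From now on [b] replaces [v] in each call; a call between the two becomes void and is dropped,
    which saves one call. *)
Lemma dominates_rcons V v b s s' c :
    b \in V -> b != v -> #|c| = 2 -> c \subset V ->
    calls (V :\ v) s' -> dominates v b s s' ->
  exists s'', [/\ calls (V :\ v) s'', dominates v b (rcons s c) s'' &
    size s'' + ((v \in c) && (b \in c)) <= (size s').+1].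
Proof.
move=> bV bv c2 cV s'V dom.
have [/andP[vc bc]|vbc] := boolP ((v \in c) && (b \in c)).
  have cE : c = [set v; b].
    apply/eqP; rewrite eq_sym eqEcard c2 cards2 eq_sym bv andbT.
    by rewrite subUset !sub1set vc.
  exists s'; split=> //=; last by rewrite addn1.
  move=> x xv z; rewrite spread_rcons in_step => /orP[|/andP[zc /meetP[y ys yc]]].
    exact: dom.
  suff -> : stand_in v b z = stand_in v b y by exact: dom.
  by move: zc yc; rewrite cE !inE /stand_in => /pred2P[]-> /pred2P[]->;
    rewrite ?eqxx ?(negbTE bv).
exists (rcons s' (stand_in v b @: c)); split=> [|x xv z|]; last first.
- by rewrite size_rcons addn0.
- rewrite !spread_rcons !in_step => /orP[zs|/andP[zc /meetP[y ys yc]]].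
    by rewrite dom.
  apply/orP; right; rewrite imset_f //=; apply/meetP.
  by exists (stand_in v b y); [exact: dom | exact: imset_f].
rewrite /calls all_rcons [all _ _]s'V andbT; apply/andP; split.
  rewrite card_in_imset ?c2 // => y z yc zc; rewrite /stand_in.
  case: eqP yc zc => [->|_] yc zc; case: eqP zc => [->|_] zc //.
    by move=> bz; move: vbc; rewrite yc bz zc.
  by move=> yb; move: vbc; rewrite zc -yb yc.
apply/subsetP=> _ /imsetP[y yc ->]; rewrite !inE stand_in_neq //=.
by rewrite /stand_in; case: ifP => // _; apply: (subsetP cV).
Qed.

(** Induction on the last call. The partner in the first call of [v] takes over her role, that call
    being dropped, and the role moves on until [b] holds it. *)
Lemma role_transfer V v s b :
    calls V s -> v \in V -> b != v -> b \in spread s [set v] ->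
  exists s', [/\ calls (V :\ v) s', dominates v b s s' & size s' < size s].
Proof.
move=> sV vV; elim/last_ind: s b sV => [b _ /negbTE|s c IHs b].
  by rewrite inE => ->.
rewrite /calls all_rcons size_rcons => /andP[/andP[/eqP c2 cV] sV] bv bs.
have /subsetP cV' := cV.
have [bs'|nbs] := boolP (b \in spread s [set v]).
  have [s1 [s1V s1D s1s]] := IHs b sV bv bs'.
  have bV : b \in V by apply: (subsetP (calls_spread sV vV)).
  have [s2 [? ? s2s]] := dominates_rcons bV bv c2 cV s1V s1D.
  by exists s2; split=> //; move: s1s s2s; case: (_ && _); clear; lia.
move: bs; rewrite spread_rcons in_step (negbTE nbs) /=.
case/andP=> bc /meetP[d ds dc].
have bd : b != d by apply: contraNneq nbs => ->.
have cE : c = [set b; d].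
  by apply/eqP; rewrite eq_sym eqEcard c2 cards2 bd andbT subUset !sub1set bc.
(* An informant [d] other than [v] plays [v] up to [c], where [b] learns all that [d] holds and
   takes over. *)
have [dv|dv] := eqVneq d v; last first.
  have [s1 [s1V s1D s1s]] := IHs d sV dv ds.
  have vc : v \notin c by rewrite cE !inE negb_or eq_sym bv eq_sym.
  exists (rcons s1 c); split; last by rewrite size_rcons.
    rewrite /calls all_rcons [all _ _]s1V c2 andbT /=; apply/subsetP=> y yc.
    by rewrite !inE cV' // andbT; apply: contraNneq vc => <-.
  move=> x xv z; rewrite !spread_rcons !in_step => /orP[zs|/andP[zc /meetP[y ys yc]]].
    have := s1D x xv z zs; rewrite /stand_in; case: ifP => [_ d1|_ ->//].
    by apply/orP; right; rewrite bc; apply/meetP; exists d.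
  have nv t : t \in c -> t != v by apply: contraTneq => ->.
  have := s1D x xv y ys; rewrite /stand_in !(negbTE (nv _ _)) // => y1.
  by rewrite zc (introT (meetP _ _)) ?orbT //; exists y.
move: ds dc cE bd; rewrite dv => _ vc cE _ {d dv}.
(* If [c] is the first call of [v], she brings only her own item to it, and [s] itself serves. *)
have [/allP vs|] := boolP (all (fun c' : {set T} => v \notin c') s).
  exists s; split=> // [|x xv z].
    apply/allP=> c' c's; have /andP[-> c'V] := allP sV _ c's.
    by rewrite subsetD1 c'V vs.
  have vx : v \notin spread s [set x].
    by rewrite spread_avoid ?inE 1?eq_sym //; apply/allP.
  rewrite spread_rcons in_step /stand_in => /orP[zs|/andP[zc /meetP[y ys yc]]].
    by case: eqP zs => // ->; rewrite (negbTE vx).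
  have yb : y = b.
    by move: yc ys; rewrite cE !inE => /pred2P[]-> //; rewrite (negbTE vx).
  by move: zc ys; rewrite cE !inE yb => /pred2P[]-> //; rewrite ?(negbTE bv) ?eqxx.
(* Otherwise an earlier partner [d] plays [v], and a call between [d] and [b] replaces [c]. *)
case/allPn=> c' c's; rewrite negbK => vc'.
have [d dc' dv] : exists2 d, d \in c' & d != v.
  have /andP[/cards2P[p [q [pq c'E]]] _] := allP sV _ c's.
  have : v \in [set p; q] by rewrite -c'E.
  rewrite c'E !inE => /pred2P[]->; first by exists q; rewrite ?inE ?eqxx ?orbT // eq_sym.
  by exists p; rewrite ?inE ?eqxx.
have ds : d \in spread s [set v].
  have [u w] := splitPr c's.
  rewrite spread_cat /=; apply: (subsetP (sub_spread w _)).
  rewrite in_step dc' /=; apply/orP; right; apply/meetP.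
  by exists v => //; exact: spread_self.
have [s1 [s1V s1D s1s]] := IHs d sV dv ds.
have db : d != b by apply: contraNneq nbs => <-.
exists (rcons s1 [set d; b]); split; last by rewrite size_rcons.
  rewrite /calls all_rcons [all _ _]s1V cards2 db subUset !sub1set !inE.
  by rewrite dv bv (cV' _ bc) andbT /= andbT; apply: (subsetP (calls_spread sV vV)).
move=> x xv z; rewrite !spread_rcons !in_step => zs.
have D y : y \in spread s [set x] -> y \in c -> b \in step (spread s1 [set x]) [set d; b].
  rewrite cE !inE => ys /pred2P[] yE; have := s1D x xv _ ys; rewrite yE /stand_in.
    by rewrite (negbTE bv) in_step => ->.
  rewrite eqxx in_step !inE eqxx orbT => d1; apply/orP; right.
  by apply/meetP; exists d; rewrite // !inE eqxx.
case/orP: zs => [zs|/andP[zc /meetP[y ys yc]]].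
  have [zv|zv] := eqVneq z v.
    by have := D z zs; rewrite zv /stand_in eqxx in_step; apply.
  by have := s1D x xv z zs; rewrite /stand_in (negbTE zv) => ->.
have -> : stand_in v b z = b.
  by move: zc; rewrite cE !inE /stand_in => /pred2P[]->; rewrite ?eqxx ?(negbTE bv).
by have := D y ys yc; rewrite in_step.
Qed.

(* The person [x] is removed: her first call and the call in which she hears her
   own item are dropped, and her role is handed down the path that her item
   follows. *)
Lemma hears_own_reduction V s1 s2 x z :
    calls V (s1 ++ s2) -> x \in V -> z != x ->
    z \in spread s1 [set x] -> x \in spread s2 [set z] ->
  exists s', [/\ calls (V :\ x) s', size s' + 2 <= size (s1 ++ s2) &
    tot V (s1 ++ s2) + 1 <= tot (V :\ x) s' + 2 * #|V|].
Proof.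
move=> sV xV zx zs1 xs2.
have [|u [c [w [p [s2E xc pc px pu]]]]] := spread_enter xs2.
  by rewrite inE eq_sym.
have sE : s1 ++ s2 = rcons (s1 ++ u) c ++ w by rewrite s2E cat_rcons catA.
rewrite sE in sV *.
have : calls V (rcons (s1 ++ u) c) /\ calls V w.
  by move: sV; rewrite /calls all_cat => /andP[].
case; rewrite {1}/calls all_rcons => /andP[/andP[/eqP c2 cV] s1V] wV.
have ps : p \in spread (s1 ++ u) [set x].
  by rewrite spread_cat; apply: (subsetP (spreadS u _)) pu; rewrite sub1set.
have pV : p \in V by apply: (subsetP cV).
have [t1 [t1V t1D t1s]] := role_transfer s1V xV px ps.
have [t2 [t2V t2D t2s]] := dominates_rcons pV px c2 cV t1V t1D.
rewrite xc pc /= in t2s.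
have [t [tV tD ts]] : exists t, [/\ calls (V :\ x) t,
    dominates x p (rcons (s1 ++ u) c ++ w) t & size t <= size t2 + size w].
  elim/last_ind: w wV {sV sE s2E} => [_|w c' IHw].
    by exists t2; rewrite cats0 addn0.
  rewrite /calls all_rcons => /andP[/andP[/eqP c'2 c'V] wV].
  have [t [tV tD ts]] := IHw wV.
  have [t' [t'V t'D t's]] := dominates_rcons pV px c'2 c'V tV tD.
  exists t'; rewrite -rcons_cat size_rcons; split=> //.
  by move: ts t's; case: (_ && _); clear; lia.
exists t; split=> //.
  by rewrite size_cat size_rcons; move: t1s t2s ts; clear; lia.
set s := _ ++ w in tD sV *; rewrite /tot (big_setD1 x) //=.
(* The item of [x] contributes at most [#|V|], and each other item loses at most the holder [x]. *)
have le1 : #|spread s [set x]| <= #|V| by apply/subset_leq_card/calls_spread.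
have : \sum_(y in V :\ x) #|spread s [set y]| <=
       \sum_(y in V :\ x) (#|spread t [set y]| + 1).
  apply: leq_sum => y; rewrite !inE => /andP[yx yV].
  rewrite (cardsD1 x) addnC leq_add //; last by case: (x \in _).
  apply/subset_leq_card/subsetP=> q; rewrite !inE => /andP[qx qs].
  by have := tD y yx q qs; rewrite /stand_in (negbTE qx).
rewrite big_split sum1_card /=; have := cardsD1 x V; rewrite xV.
by move: le1; clear; lia.
Qed.

End Substitution.

(** * Histories without own gossip *)

(** What is used about travelling items, stated so that it fits both directions of time: [K i x] is
    the reach of [x] on arrival at call [i], [E x] the reach after all calls. *)
Record flow (T I : finType) (call : I -> {set T}) (lt : rel I)
    (K : I -> T -> {set T}) (E : T -> {set T}) : Prop := Flow {
  flow_self : forall i x, x \in K i x;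
  flow_selfE : forall x, x \in E x;
  flow_step : forall i j x y z, lt i j ->
    y \in call i -> y \in K i x -> z \in call i -> z \in K j x;
  flow_mono : forall i j x z, lt i j -> z \in K i x -> z \in K j x;
  flow_elim : forall j x z, z \in K j x -> z != x -> exists i y,
    [/\ lt i j, z \in call i, y \in call i, y \in K i x & z \notin K i x];
  flow_stepE : forall i x y z,
    y \in call i -> y \in K i x -> z \in call i -> z \in E x;
  flow_elimE : forall x z, z \in E x -> z != x -> exists i y,
    [/\ z \in call i, y \in call i, y \in K i x & z \notin K i x]
}.

(* A sequence of calls, indexed by ['I_m], in which nobody hears her own item.
   [knows i x]: the people who know the item of [x] just before call [i];
   [feeds i x]: the people whose knowledge just after call [i] reaches [x];
   [learned x] and [sources x]: the same for the whole sequence.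
   The interface is symmetric under time reversal. *)
Record history (T : finType) (V : {set T}) (m : nat) := History {
  call : 'I_m -> {set T};
  before : rel 'I_m;
  knows : 'I_m -> T -> {set T};
  feeds : 'I_m -> T -> {set T};
  learned : T -> {set T};
  sources : T -> {set T};
  card_call : forall i, #|call i| = 2;
  call_sub : forall i, call i \subset V;
  before_irr : irreflexive before;
  before_trans : transitive before;
  before_total : forall i j, i != j -> before i j || before j i;
  learned_sources : forall x z, (z \in learned x) = (x \in sources z);
  learned_sub : forall x, x \in V -> learned x \subset V;
  sources_sub : forall x, x \in V -> sources x \subset V;
  fwd : flow call before knows learned;
  bwd : flow call (fun i j => before j i) feeds sources;
  noho : forall i x z, z \in knows i x -> z \in feeds i x -> z = x;
  noho_knows : forall i x y z, z \in knows i x -> z \in call i ->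
    y \in call i -> y \in feeds i x -> z = x;
  noho_feeds : forall i x y z, z \in feeds i x -> z \in call i ->
    y \in call i -> y \in knows i x -> z = x
}.

Definition dual (T : finType) (V : {set T}) (m : nat) (h : history V m) :
  history V m.
Proof.
refine (@History T V m (call h) (fun i j => before h j i) (feeds h) (knows h)
  (sources h) (learned h) (card_call h) (call_sub h) (before_irr h) _ _ _
  (@sources_sub _ _ _ h) (@learned_sub _ _ _ h) (bwd h) (fwd h) _
  (@noho_feeds _ _ _ h) (@noho_knows _ _ _ h)).
- by move=> j i k ij jk; apply: before_trans jk ij.
- by move=> i j ij; rewrite orbC before_total.
- by move=> x z; rewrite learned_sources.
- by move=> i x z zf zk; apply: noho zk zf.
Defined.

Section History.
Variables (T : finType) (V : {set T}) (m : nat).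
Implicit Types (h : history V m) (x y z v w : T) (i j k : 'I_m).

Lemma callE h i y z : y \in call h i -> z \in call h i -> y != z ->
  call h i = [set y; z].
Proof.
move=> yi zi yz; apply/eqP; rewrite eq_sym eqEcard card_call cards2 yz andbT.
by rewrite subUset !sub1set yi.
Qed.

Lemma partner h i x : x \in call h i ->
  exists y, [/\ y != x, y \in call h i & call h i = [set x; y]].
Proof.
move=> xi; have /eqP/cards2P[p [q [pq E]]] := card_call h i.
have /pred2P[xE|xE] : (x == p) || (x == q) by move: xi; rewrite E !inE.
  by exists q; rewrite E !inE eqxx orbT xE eq_sym.
by exists p; rewrite E !inE eqxx xE setUC.
Qed.

Definition calls_of h x := [set i | x \in call h i].
(** The O-useful calls for [x]; [tells (dual h) x] are the I-useful ones. *)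
Definition tells h x := [set i | #|call h i :&: knows h i x| == 1].
Definition useless h x := ~: (tells h x :|: tells (dual h) x).

Lemma tells_intro h i x y z : y \in call h i -> y \in knows h i x ->
  z \in call h i -> z \notin knows h i x -> i \in tells h x.
Proof.
move=> yi yk zi zk; have yz : y != z by apply: contraNneq zk => <-.
rewrite inE (callE yi zi yz); apply/cards1P; exists y; apply/setP=> t.
rewrite !inE; have [->|_] := eqVneq t y; first by rewrite yk.
by have [->|_] := eqVneq t z; rewrite ?(negbTE zk).
Qed.

Lemma tells_elim h i x : i \in tells h x -> exists y z,
  [/\ call h i = [set y; z], y != z, y \in knows h i x & z \notin knows h i x].
Proof.
rewrite inE => /cards1P[y yE].
have : y \in call h i :&: knows h i x by rewrite yE inE.
rewrite inE => /andP[yi yk]; have [z [zy zi iE]] := partner yi.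
exists y, z; split; rewrite 1?eq_sym //; apply: contraNN zy => zk.
by have : z \in call h i :&: knows h i x; [rewrite inE zi | rewrite yE inE].
Qed.

Lemma tells_notsub h i x y z : i \in tells h x -> y \in call h i -> z \in call h i ->
  y != z -> y \in knows h i x -> z \notin knows h i x.
Proof.
case/tells_elim=> p [q [E pq pk qk]]; rewrite E !inE.
by move=> /pred2P[]-> /pred2P[]->; rewrite ?eqxx // (negbTE qk).
Qed.

Lemma tells_out h i x z : i \in tells h x -> z \in call h i -> z \in learned h x.
Proof.
case/tells_elim=> p [q [E pq pk qk]] zi.
by apply: (flow_stepE (fwd h)) pk zi; rewrite E !inE eqxx.
Qed.

Lemma tells_after h i j x z : i \in tells h x -> before h i j ->
  z \in call h i -> z \in knows h j x.
Proof.
case/tells_elim=> p [q [E pq pk qk]] ij zi.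
by apply: (flow_step (fwd h) ij) pk zi; rewrite E !inE eqxx.
Qed.

(** A call in [tells h x] has exactly one uninformed participant, so the default [x] does not arise
    there. *)
Definition learner h x i := odflt x [pick z in call h i :\: knows h i x].

Lemma learnerP h x i : i \in tells h x ->
  learner h x i \in call h i /\ learner h x i \notin knows h i x.
Proof.
case/tells_elim=> p [q [E pq pk qk]]; rewrite /learner; case: pickP => [z|/(_ q)].
  by rewrite inE => /andP[].
by rewrite !inE (negbTE qk) E !inE eqxx orbT.
Qed.

Lemma learner_eq h x i z : i \in tells h x -> z \in call h i ->
  z \notin knows h i x -> learner h x i = z.
Proof.
move=> iO zi zk; have [fi fk] := learnerP iO.
apply/eqP; apply: contraTT iO => fz; rewrite inE (callE fi zi fz).
rewrite (_ : _ :&: _ = set0) ?cards0 //; apply/setP=> t; rewrite !inE.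
by case: eqP => [->|_]; [|case: eqP => [->|//]]; rewrite /= ?(negbTE fk) ?(negbTE zk).
Qed.

Lemma learner_inj h x : {in tells h x &, injective (learner h x)}.
Proof.
move=> i j iO jO fij; apply/eqP; apply: contraT => /(before_total h).
have [fi fik] := learnerP iO; have [fj fjk] := learnerP jO.
case/orP=> lt_ij; first by move: fjk; rewrite -fij (tells_after iO lt_ij fi).
by move: fik; rewrite fij (tells_after jO lt_ij fj).
Qed.

Lemma card_learned h x : #|learned h x :\ x| = #|tells h x|.
Proof.
rewrite -(card_in_imset (@learner_inj h x)).
apply: eq_card => z; apply/idP/imsetP => [|[i iO ->]]; last first.
  have [fi fk] := learnerP iO; rewrite !inE (tells_out iO fi) andbT.
  by apply: contraNneq fk => ->; apply: (flow_self (fwd h)).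
rewrite !inE => /andP[zx zl].
have [i [y [zi yi yk zk]]] := flow_elimE (fwd h) zl zx.
have iO := tells_intro yi yk zi zk; exists i => //.
by rewrite (learner_eq iO zi zk).
Qed.

(** A partner who already knew the item would bring it home to [x]. *)
Lemma tells_own h x i : x \in call h i -> i \in tells h x.
Proof.
move=> xi; have [y [yx yi _]] := partner xi.
apply: (tells_intro xi (flow_self (fwd h) i x) yi).
by apply: contraNN yx => yk; rewrite (noho_knows yk yi xi (flow_self (bwd h) i x)).
Qed.

(** In a call of both kinds somebody knows the item of [x] before and somebody can send to [x]
    after; as [x] does not hear her own item, the informed participant is [x] herself. *)
Lemma tellsI h x : tells h x :&: tells (dual h) x = calls_of h x.
Proof.
apply/setP=> i; rewrite in_setI [in RHS]inE; apply/andP/idP => [[iO iI]|xi].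
  have [y [z [E yz yk zk]]] := tells_elim iO.
  have [y' [z' [E' yz' yk' zk']]] := tells_elim iI.
  have yi : y \in call h i by rewrite E !inE eqxx.
  have yi' : y' \in call h i by rewrite [call _ _]E' !inE eqxx.
  by rewrite -(noho_knows yk yi yi' yk').
by rewrite tells_own // (tells_own (h := dual h)).
Qed.

Lemma tells_card h x :
  #|tells h x| + #|tells (dual h) x| + #|useless h x| = m + #|calls_of h x|.
Proof.
have := cardsUI (tells h x) (tells (dual h) x); rewrite tellsI.
by have := cardsC (tells h x :|: tells (dual h) x); rewrite card_ord /useless; clear; lia.
Qed.

(** * Pairs that never communicate *)

Definition missing h := [set p in setX V V | p.2 \notin learned h p.1].
Definition missing_at h x := [set p in missing h | (p.1 == x) || (p.2 == x)].

Lemma in_missing h x z :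
  ((x, z) \in missing h) = [&& x \in V, z \in V & z \notin learned h x].
Proof. by rewrite inE in_setX /= andbA. Qed.

Lemma missing_dual h x z : ((x, z) \in missing (dual h)) = ((z, x) \in missing h).
Proof. by rewrite !in_missing /= -learned_sources andbCA. Qed.

Lemma card_missing_dual h : #|missing (dual h)| = #|missing h|.
Proof.
have inj : injective (fun p : T * T => (p.2, p.1)) by move=> [? ?] [? ?] [-> ->].
rewrite -(card_imset (mem (missing h)) inj).
apply: eq_card => -[x z]; rewrite missing_dual; apply/idP/imsetP => [zx|[[y t]]].
  by exists (z, x).
by move=> zx [-> ->].
Qed.

(** By [card_learned] in both directions, the useful calls count the people reached by [x] and
    reaching [x]; the 2 stands for [x] herself on either side. The two families of missing pairs are
    disjoint because [(x, x)] is not missing. *)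
Lemma missing_at_card h x : x \in V ->
  #|missing_at h x| + #|tells h x| + #|tells (dual h) x| + 2 = 2 * #|V|.
Proof.
move=> xV; have lx := flow_selfE (fwd h) x; have sx := flow_selfE (bwd h) x.
have -> : missing_at h x = [set (x, z) | z in V :\: learned h x]
                       :|: [set (z, x) | z in V :\: sources h x].
  apply/setP=> -[y z]; rewrite !inE /=; apply/idP/orP.
    case/andP=> /andP[/andP[yV zV] yz] /pred2P[yE|zE].
      by left; apply/imsetP; exists z; rewrite ?inE -?yE ?yz.
    by right; apply/imsetP; exists y; rewrite ?inE -?zE // -learned_sources yz.
  case=> /imsetP[t]; rewrite inE => /andP[tn tV] [-> ->].
    by rewrite xV tV tn eqxx.
  by rewrite xV tV learned_sources tn eqxx orbT.
rewrite cardsU !card_imset; try by move=> y z [].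

have -> : [set (x, z) | z in V :\: learned h x]
      :&: [set (z, x) | z in V :\: sources h x] = set0.
  apply/setP=> -[y z]; rewrite !inE; apply/negP => /andP[/imsetP[t]].
  rewrite inE => /andP[tn _] [_ ->] /imsetP[u]; rewrite inE => /andP[un _] [_ tx].
  by move: tn; rewrite tx lx.
have cl := card_learned h x; have cs := card_learned (dual h) x.
have ls := cardsID (learned h x) V; have ss := cardsID (sources h x) V.
move: ls ss; rewrite (setIidPr (learned_sub h xV)) (setIidPr (sources_sub h xV)).
rewrite cards0 (cardsD1 x (learned h x)) lx (cardsD1 x (sources h x)) sx.
by rewrite cl [#|sources h x :\ x|]cs; clear; lia.
Qed.

Lemma sum_calls_of h : \sum_(x in V) #|calls_of h x| = m * 2.
Proof.
rewrite (eq_bigr (fun x => \sum_(i : 'I_m) (x \in call h i))) => [|x _]; last first.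
  by rewrite -sum1_card big_mkcond; apply: eq_bigr => i _; rewrite inE; case: ifP.
rewrite exchange_big /= -[in RHS](card_ord m) -sum_nat_const; apply: eq_bigr => i _.
rewrite -(card_call h i) -sum1_card [RHS]big_mkcond [LHS]big_mkcond.
apply: eq_bigr => x _ /=.
by have := subsetP (call_sub h i) x; case: (x \in call _ _); case: (x \in V) => // /(_ isT).
Qed.

Lemma sum_missing_at h : \sum_(x in V) #|missing_at h x| <= 2 * #|missing h|.
Proof.
rewrite (eq_bigr (fun x => \sum_(p in missing h) ((p.1 == x) || (p.2 == x)))) => [|x _].
  rewrite exchange_big mulnC -sum_nat_const; apply: leq_sum => p _.
  apply: leq_trans (_ : \sum_x ((p.1 == x) + (p.2 == x)) <= _).
    rewrite big_mkcond; apply: leq_sum => x _.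
    by case: (x \in V); case: (p.1 == x); case: (p.2 == x).
  have sum_eq a : \sum_(x : T) (a == x) = 1.
    by rewrite (bigD1 a) //= eqxx big1 // => x; rewrite eq_sym => /negbTE->.
  by rewrite big_split /= !sum_eq.
rewrite -sum1_card [LHS]big_mkcond [RHS]big_mkcond; apply: eq_bigr => p _.
by rewrite [p \in missing_at _ _]inE; case: (p \in _); case: (_ || _).
Qed.

(** The useless calls are discarded; the numbers of calls per person add up to [2 * m], and each
    missing pair is counted at most twice. *)
Lemma missing_lower_bound h :
  2 * (#|V| * #|V|) <= 2 * #|missing h| + #|V| * (m + 2) + 2 * m.
Proof.
have : \sum_(x in V) 2 * #|V| <=
    \sum_(x in V) (#|missing_at h x| + (m + 2) + #|calls_of h x|).
  apply: leq_sum => x xV; have := missing_at_card h xV; have := tells_card h x; clear; lia.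
rewrite !big_split /= sum_calls_of !sum_nat_const.
have := sum_missing_at h; set S := \sum_(x in V) _; move: S #|_| #|V| m; clear; lia.
Qed.

End History.

(** * People with few calls *)

Section LowDegree.
Variables (T : finType) (V : {set T}) (m : nat).
Implicit Types (h : history V m) (x y z v w : T) (i j k : 'I_m).

(** When a pair calls again, each of them would hear her own item. *)
Lemma call_inj h : injective (call h).
Proof.
move=> i j; wlog ij : i j / before h i j => [W|] E.
  apply/eqP; apply: contraT => ij; have /orP[lt_ij|lt_ji] := before_total h ij.
    by rewrite (W i j) ?eqxx // in ij.
  by rewrite (W j i) ?eqxx // in ij.
have /eqP/cards2P[a [b [ab iE]]] := card_call h i.
have ai : a \in call h i by rewrite iE !inE eqxx.
have bi : b \in call h i by rewrite iE !inE eqxx orbT.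
have bk := flow_step (fwd h) ij ai (flow_self (fwd h) i a) bi.
rewrite E in ai bi; have := noho_knows bk bi ai (flow_self (bwd h) j a).
by move=> ba; rewrite ba eqxx in ab.
Qed.

Lemma card_common_calls h v w : v != w -> #|calls_of h v :&: calls_of h w| <= 1.
Proof.
move=> vw; apply/card_le1_eqP => i j; rewrite !inE => /andP[vi wi] /andP[vj wj].
by apply: (@call_inj h); rewrite (callE vi wi) // (callE vj wj).
Qed.

Lemma missing_at_sub h x : missing_at h x \subset missing h.
Proof. by apply/subsetP=> p; rewrite inE => /andP[]. Qed.

Lemma missing_at_dual h x : x \in V -> #|missing_at (dual h) x| = #|missing_at h x|.
Proof.
move=> xV; have := missing_at_card h xV; have := missing_at_card (dual h) xV.
have -> : tells (dual (dual h)) x = tells h x by [].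
by clear; lia.
Qed.

Lemma missing_at_calls_of h x : m + 5 = 2 * #|V| -> x \in V ->
  #|missing_at h x| + #|calls_of h x| = 3 + #|useless h x|.
Proof.
move=> m5 xV; have := missing_at_card h xV; have := tells_card h x.
by move: m5; clear; lia.
Qed.

(** Without calls [x] is in at least three missing pairs. With a single call, to [y], anybody except
    [y] who both reaches [x] and is reached by her would hear her own item through [y]; so at least
    [#|V| - 2] pairs are missing. *)
Lemma two_le_calls_of h x : m + 5 = 2 * #|V| -> 4 < #|V| ->
  #|missing h| <= 2 -> x \in V -> 1 < #|calls_of h x|.
Proof.
move=> m5 n5 few xV; rewrite ltnNge; apply/negP => deg1.
have few_x := leq_trans (subset_leq_card (missing_at_sub h x)) few.
have := missing_at_calls_of h m5 xV; case: (posnP #|calls_of h x|) => [->|deg].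
  by move: few_x; clear; lia.
have /cards1P[i0 callsE] : #|calls_of h x| == 1 by rewrite eqn_leq deg1 deg.
have only i : x \in call h i -> i = i0.
  by move=> xi; apply/set1P; rewrite -callsE inE.
have xi0 : x \in call h i0 by have := set11 i0; rewrite -callsE inE.
have [y [yx yi0 i0E]] := partner xi0.
have common : (learned h x :\ x) :&: (sources h x :\ x) \subset [set y].
  apply/subsetP=> z; rewrite !inE => /andP[/andP[zx zl] /andP[_ zs]].
  rewrite learned_sources in zl; rewrite -learned_sources in zs.
  have xz : x != z by rewrite eq_sym.
  have [i [p [xi pi pf xf]]] := flow_elimE (bwd h) zl xz.
  have [j [q [xj qj qk xk]]] := flow_elimE (fwd h) zs xz.
  move: pi qj pf qk xf xk; rewrite (only _ xi) (only _ xj) i0E !inE.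
  move=> /pred2P[]-> /pred2P[]->; try by move=> -> // _ /negP.
    by move=> _ -> _ /negP.
  by move=> yf yk _ _; rewrite (noho yk yf).
have := missing_at_card h xV.
have := cardsUI (learned h x :\ x) (sources h x :\ x).
have -> : #|learned h x :\ x| = #|tells h x| by exact: card_learned.
have -> : #|sources h x :\ x| = #|tells (dual h) x| by exact: (card_learned (dual h)).
have := subset_leq_card common; rewrite cards1.
have : #|(learned h x :\ x) :|: (sources h x :\ x)| <= #|V :\ x|.
  by apply: subset_leq_card; rewrite subUset !setSD ?learned_sub ?sources_sub.
have := cardsD1 x V; rewrite xV; move: few_x n5; clear; lia.
Qed.

(** * People with exactly two calls *)

Definition known h i y := [set z in V | y \in knows h i z].
Definition fed h i y := known (dual h) i y.

Definition two_calls h x i1 y1 i2 y2 :=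
  [/\ before h i1 i2, call h i1 = [set x; y1], call h i2 = [set x; y2],
      x != y1 /\ x != y2 & calls_of h x = [set i1; i2]].

(* What deleting a person with exactly two calls yields when the claim is known
   for one person less. *)
Definition deletable h := forall x i1 y1 i2 y2, two_calls h x i1 y1 i2 y2 ->
  #|missing_at h x| + 3 <= #|missing h| +
    #|known h i1 y1 :\: known h i2 y2| * #|fed h i2 y2 :\: fed h i1 y1|.

Lemma two_calls_dual h x i1 y1 i2 y2 :
  two_calls h x i1 y1 i2 y2 -> two_calls (dual h) x i2 y2 i1 y1.
Proof. by case=> i12 E1 E2 [n1 n2] cs; split; rewrite // [calls_of _ _]cs setUC. Qed.

Lemma two_callsV h x i1 y1 i2 y2 : two_calls h x i1 y1 i2 y2 -> x \in V.
Proof.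
by case=> _ E1 _ _ _; apply: (subsetP (call_sub h i1)); rewrite E1 !inE eqxx.
Qed.

Lemma deletable_dual h : deletable h -> deletable (dual h).
Proof.
move=> del x i1 y1 i2 y2 tc; have := del _ _ _ _ _ (two_calls_dual tc).
have xV := two_callsV tc; rewrite missing_at_dual // card_missing_dual.
by rewrite mulnC.
Qed.

Lemma two_callsP h x : #|calls_of h x| = 2 ->
  exists i1 y1 i2 y2, two_calls h x i1 y1 i2 y2.
Proof.
move/eqP/cards2P=> [i [j [ij csE]]].
wlog lt_ij : i j ij csE / before h i j => [W|].
  have /orP[lt_ij|lt_ij] := before_total h ij; first exact: W lt_ij.
  by apply: (W j i) lt_ij; rewrite 1?eq_sym // setUC.
have xi : x \in call h i by have := set21 i j; rewrite -csE inE.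
have xj : x \in call h j by have := set22 i j; rewrite -csE inE.
have [y1 [n1 _ E1]] := partner xi; have [y2 [n2 _ E2]] := partner xj.
by exists i, y1, j, y2; split=> //; split; rewrite eq_sym.
Qed.

(** [x] gets the item of [w] in her first call; if the item of [x] reached [w], that of [w] would
    come home with it. *)
Lemma known_missing h x i1 y1 i2 y2 w : two_calls h x i1 y1 i2 y2 ->
  w \in known h i1 y1 :\ y1 ->
  [/\ (x, w) \in missing h, (w, x) \notin missing h & w != x].
Proof.
move=> tc; have xV := two_callsV tc; case: tc => i12 E1 E2 [n1 n2] cs.
case/setD1P=> wy /setIdP[wV yk].
have x1 : x \in call h i1 by rewrite E1 !inE eqxx.
have y11 : y1 \in call h i1 by rewrite E1 !inE eqxx orbT.
have x2 : x \in call h i2 by rewrite E2 !inE eqxx.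
have wx : w != x.
  apply: contraNneq n1 => wx; rewrite wx in yk.
  by rewrite (noho_knows yk y11 x1 (flow_self (bwd h) i1 x)).
have xlw := flow_stepE (fwd h) y11 yk x1.
split=> //; last by rewrite in_missing xlw !andbF.
rewrite in_missing xV wV /=; apply/negP; rewrite learned_sources => xs.
have xw : x != w by rewrite eq_sym.
have [j [p [xj pj pf xf]]] := flow_elimE (bwd h) xs xw.
have : j \in [set i1; i2] by rewrite -cs inE.
rewrite !inE => /pred2P[] jE; move: pj pf xf; rewrite jE.
  rewrite E1 !inE => /pred2P[]->; first by move=> -> //.
  by move=> yf _; rewrite -(noho yk yf) eqxx in wy.
move=> p2 pf xf; have xk := flow_step (fwd h) i12 y11 yk x1.
by rewrite -(noho_knows xk x2 p2 pf) eqxx in wx.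
Qed.

Lemma missing_at_ge h x i1 y1 i2 y2 : two_calls h x i1 y1 i2 y2 ->
  #|known h i1 y1 :\ y1| + #|fed h i2 y2 :\ y2| <= #|missing_at h x|.
Proof.
move=> tc; have tc' := two_calls_dual tc.
have injl : injective (fun w : T => (x, w)) by move=> ? ? [].
have injr : injective (fun w : T => (w, x)) by move=> ? ? [].
rewrite -(card_imset (mem (known h i1 y1 :\ y1)) injl).
rewrite -(card_imset (mem (fed h i2 y2 :\ y2)) injr) -cardsUI.
rewrite [X in _ + X](_ : _ = 0) ?addn0.
  apply/subset_leq_card/subsetP=> p /setUP[/imsetP[w wW ->]|/imsetP[w wW ->]].
    have [wm _ _] := known_missing tc wW.
    by rewrite /missing_at in_set wm eqxx.
  have [wm _ _] := known_missing tc' wW.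
  by rewrite missing_dual in wm; rewrite /missing_at in_set wm eqxx orbT.
apply/eqP; rewrite cards_eq0 -subset0; apply/subsetP=> _ /setIP[/imsetP[w wW ->]].
case/imsetP=> w' _ [_ wx]; have [_ _] := known_missing tc wW.
by rewrite wx eqxx.
Qed.

(* The last call of a path from [u] to [x] reaches [x] through some [y] that by
   then has received everything [u] knew just after call [i]. *)
Lemma feeds_route h x i u : u \in feeds h i x -> u != x ->
  exists j y, [/\ x \in call h j, y \in call h j, y != x & forall p,
    u \in knows h i p \/
    u \in call h i /\ (exists2 q, q \in call h i & q \in knows h i p) ->
    y \in knows h j p].
Proof.
elim: {i}#|[set k | before h i k]| {-2}i (leqnn #|[set k | before h i k]|) u => [|d IHd] i.
  rewrite leqn0 cards_eq0 => /eqP i_last u uf ux.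
  have [j [y [ij _ _ _ _]]] := flow_elim (bwd h) uf ux.
  have : j \in [set k | before h i k] by rewrite inE.
  by rewrite i_last inE.
move=> le_d u uf ux; have [j [y [ij uj yj yf _]]] := flow_elim (bwd h) uf ux.
have uk p : u \in knows h i p \/
    u \in call h i /\ (exists2 q, q \in call h i & q \in knows h i p) -> u \in knows h j p.
  case=> [|[ui [q qi qk]]]; first exact: flow_mono (fwd h) _ _ _ _ ij.
  exact: flow_step (fwd h) _ _ _ _ _ ij qi qk ui.
have [yx|yx] := eqVneq y x.
  by exists j, u; split=> //; rewrite -yx.
have [|k [z [xk zk zx zP]]] := IHd j _ y yf yx.
  rewrite -ltnS; apply: leq_trans le_d; apply: proper_card; apply/properP; split.
    by apply/subsetP=> k; rewrite !inE; apply: before_trans ij.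
  by exists j; rewrite !inE ?ij ?before_irr.
by exists k, z; split=> // p /uk uk'; apply: zP; right; split=> //; exists u.
Qed.

(** Nobody in [W] learns the item of [x], so a call meeting [W] is useless for [x] or only I-useful.
    Calls of the latter kind are counted by the participant for whom they are the last chance to
    reach [x], and she lies in [W]. *)
Lemma card_calls_meeting h x i1 y1 i2 y2 (W := known h i1 y1 :\ y1) :
    two_calls h x i1 y1 i2 y2 -> [disjoint W & known h i2 y2] ->
  #|\bigcup_(w in W) calls_of h w| <= #|W| + #|useless h x|.
Proof.
move=> tc dis; have xV := two_callsV tc; have [i12 E1 E2 [n1 n2] cs] := tc.
set S := \bigcup_(w in W) _.
have x1 : x \in call h i1 by rewrite E1 !inE eqxx.
have y11 : y1 \in call h i1 by rewrite E1 !inE eqxx orbT.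
have notO i : i \in S -> i \notin tells h x.
  case/bigcupP=> w wW; rewrite inE => wi; apply/negP => /tells_out/(_ wi).
  by have [] := known_missing tc wW; rewrite in_missing => /and3P[_ _ /negP].
have SE : S \subset useless h x :|: (S :&: tells (dual h) x).
  apply/subsetP=> i iS; rewrite in_setU in_setI iS /useless in_setC in_setU.
  by rewrite (negbTE (notO i iS)) /= orNb.
apply: leq_trans (subset_leq_card SE) _; apply: leq_trans (leq_card_setU _ _) _.
rewrite addnC leq_add2r.
rewrite -(@card_in_imset _ _ (learner (dual h) x)); last first.
  by move=> i j /setIP[_ iI] /setIP[_ jI]; apply: learner_inj.
apply/subset_leq_card/subsetP=> _ /imsetP[i /setIP[iS iI] ->].
have [ti tf] := learnerP iI; set t := learner _ _ _ in ti tf *.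
have [w wW] := bigcupP iS; rewrite inE => wi.
have [wm wm' wx] := known_missing tc wW.
have [<-//|wt] := eqVneq w t.
have wf : w \in feeds h i x.
  have [p [q [E _ pf qf]]] := tells_elim iI; rewrite /= in E pf qf.
  have := tf; move: ti wi; rewrite /= E !inE => /pred2P[]tE /pred2P[]wE; move: wt;
    rewrite tE wE ?eqxx ?pf //.
(* The route from [w] into [x] also carries the item of [t]. It cannot enter [x] by [i2], since [y2]
   then knows nothing from [W]; so [y1] knows the item of [t] before [i1]. *)
have [j [y [xj yj yx yP]]] := feeds_route wf wx.
have wk : w \in known h i1 y1 by move: wW; rewrite inE => /andP[].
have [wV wy1] : w \in V /\ w != y1 by move: wW; rewrite !inE => /and3P[].
have ykw : y \in knows h j w by apply: yP; left; exact: (flow_self (fwd h)).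
have ykt : y \in knows h j t.
  by apply: yP; right; split=> //; exists t => //; exact: (flow_self (fwd h)).
have : j \in [set i1; i2] by rewrite -cs inE.
rewrite !inE => /pred2P[] jE; move: yj ykw ykt; rewrite jE; last first.
  rewrite E2 !inE (negbTE yx) => /eqP-> y2w.
  by have := disjointFr dis wW; rewrite inE wV y2w.
rewrite E1 !inE (negbTE yx) => /eqP-> _ ykt.
have tV : t \in V by apply: (subsetP (call_sub h i)).
rewrite tV ykt !andbT; apply/eqP => ty1.
(* Suppose [t = y1]. If [i] precedes [i1], she can still reach [x] in [i1], against the choice of
   [t]; if it follows, she hands the item of [x] to [w], who returns it. *)
have [ii1|ii1] := eqVneq i i1.
  by move: wi; rewrite ii1 E1 !inE (negbTE wx) (negbTE wy1).
have /orP[lt_i|lt_i] := before_total h ii1.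
  move/negP: tf; apply; rewrite ty1.
  exact: (flow_step (bwd h) lt_i x1 (flow_self (bwd h) i1 x) y11).
have yk : y1 \in knows h i x.
  exact: (flow_step (fwd h) lt_i x1 (flow_self (fwd h) i1 x) y11).
by rewrite (noho_knows yk _ wi wf) ?eqxx // -?ty1 in n1.
Qed.

(** A hypothetical counterexample for [r = 2], the induction hypothesis being present as
    [deletable]. *)
Definition tight h :=
  [/\ m + 5 = 2 * #|V|, 4 < #|V|, #|missing h| <= 2 & deletable h].

Lemma tight_dual h : tight h -> tight (dual h).
Proof. by case=> ? ? ? /deletable_dual; split; rewrite // card_missing_dual. Qed.

(** Let [d = #|missing_at h x|], and let [a], [b] be the sizes of the two differences in [deletable]
    without [y1], [y2]. Then [d + 1 <= (1 + a) * (1 + b)] with [a + b <= d] and [1 <= d <= 2], which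
    forces [a + b = d] and equality in the estimates behind it. *)
Lemma two_calls_shape h x i1 y1 i2 y2 : tight h -> two_calls h x i1 y1 i2 y2 ->
  [/\ [disjoint known h i1 y1 :\ y1 & known h i2 y2],
      [disjoint fed h i2 y2 :\ y2 & fed h i1 y1],
      #|known h i1 y1 :\ y1| + #|fed h i2 y2 :\ y2| = #|missing_at h x|,
      #|missing_at h x| <= 2 & #|missing_at h x| = 1 + #|useless h x|].
Proof.
case=> m5 n5 few del tc; have xV := two_callsV tc; have := del _ _ _ _ _ tc.
have := missing_at_calls_of h m5 xV; have := missing_at_ge tc.
have few_x := leq_trans (subset_leq_card (missing_at_sub h x)) few.
have bound (A B : {set T}) y : #|A :\: B| <= 1 + #|(A :\ y) :\: B|.
  by have := cardsD1 y (A :\: B); rewrite setDDl setUC -setDDl; case: (_ \in _); lia.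
have disj (A B : {set T}) : #|A| <= #|A :\: B| -> [disjoint A & B].
  move=> le; have : A :\: B == A by rewrite eqEcard subsetDl.
  by move/eqP/setDidPl.
have := bound (known h i1 y1) (known h i2 y2) y1.
have := bound (fed h i2 y2) (fed h i1 y1) y2.
have := subset_leq_card (subsetDl (known h i1 y1 :\ y1) (known h i2 y2)).
have := subset_leq_card (subsetDl (fed h i2 y2 :\ y2) (fed h i1 y1)).
have := disj (known h i1 y1 :\ y1) (known h i2 y2).
have := disj (fed h i2 y2 :\ y2) (fed h i1 y1).
have -> : #|calls_of h x| = 2.
  case: tc => i12 _ _ _ ->; rewrite cards2 (_ : i1 != i2) //.
  by apply: contraTneq i12 => ->; rewrite before_irr.
move: few few_x; clear.
move: #|missing h| #|missing_at h x| #|useless h x| => D d U.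
move: (known h i1 y1) (known h i2 y2) (fed h i2 y2) (fed h i1 y1) => A1 A2 B2 B1.
move: [disjoint _ & B1] [disjoint _ & A2] => P Q.
move: #|(A1 :\ y1) :\: A2| #|(B2 :\ y2) :\: B1| #|B2 :\: B1| #|A1 :\: A2| => a b b1 a1.
move: #|A1 :\ y1| #|B2 :\ y2| => W W'.
move=> D2 d2 HP HQ bW aW bb ba WW' dU le.
have le' : d + 3 <= D + (1 + a) * (1 + b) by apply: leq_trans le _; rewrite leq_add2l leq_mul.
have [Wa [Wb E]] : W = a /\ W' = b /\ a + b = d.
  move: a b aW bW WW' dU le' D2 d2 {ba bb le HP HQ} => [|[|[|a]]] [|[|[|b]]]; lia.
split; rewrite ?Wa ?Wb //; first by apply: HQ; rewrite Wa.
  by apply: HP; rewrite Wb.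
by move: dU; clear; lia.
Qed.

(** With one missing pair at [x] there is no useless call and, up to duality, [known h i1 y1 :\ y1]
    is a single person, left with at most one call by [card_calls_meeting]. *)
Lemma two_calls_missing_neq1 h x i1 y1 i2 y2 : tight h ->
  two_calls h x i1 y1 i2 y2 -> #|missing_at h x| != 1.
Proof.
suff half h' j1 z1 j2 z2 : tight h' -> two_calls h' x j1 z1 j2 z2 ->
    0 < #|known h' j1 z1 :\ z1| -> #|missing_at h' x| != 1.
  move=> th tc; have [_ _ E _ U] := two_calls_shape th tc.
  have [W0|] := posnP #|known h i1 y1 :\ y1|; last exact: half th tc.
  rewrite -missing_at_dual ?(two_callsV tc) //.
  apply: half (tight_dual th) (two_calls_dual tc) _.
  by change (0 < #|fed h i2 y2 :\ y2|); move: E U; rewrite W0; clear; lia.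
move=> th tc W0; apply/eqP => d1; have [disW _ E _ U] := two_calls_shape th tc.
have [m5 n5 few _] := th.
have /cards1P[w WE] : #|known h' j1 z1 :\ z1| == 1 by move: W0 E d1; clear; lia.
have := card_calls_meeting tc disW; rewrite WE big_set1 cards1.
have wV : w \in V.
  have : w \in known h' j1 z1 :\ z1 by rewrite WE set11.
  by rewrite !inE => /and3P[].
have := two_le_calls_of m5 n5 few wV.
by move: U; rewrite d1; clear; lia.
Qed.

(** If [x] has two calls, she is in both missing pairs of the history and has one useless call.
    Everybody in [W] then has at least three calls, and two people share at most one: too many for
    [#|W| + 1] calls meeting [W]. *)
Lemma two_lt_calls_of h x : tight h -> x \in V -> 2 < #|calls_of h x|.
Proof.
move=> th xV; have [m5 n5 few _] := th.
rewrite ltn_neqAle (two_le_calls_of m5 n5 few xV) andbT eq_sym; apply/eqP.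
move=> /two_callsP[i1 [y1 [i2 [y2]]]]; move: h i1 y1 i2 y2 th {few}.
suff half h i1 y1 i2 y2 : tight h -> two_calls h x i1 y1 i2 y2 ->
    0 < #|known h i1 y1 :\ y1| -> False.
  move=> h i1 y1 i2 y2 th tc; have [_ _ E _ U] := two_calls_shape th tc.
  have [W0|] := posnP #|known h i1 y1 :\ y1|; last exact: half th tc.
  apply: half (tight_dual th) (two_calls_dual tc) _.
  by change (0 < #|fed h i2 y2 :\ y2|); move: E U; rewrite W0; clear; lia.
move=> th tc W0; have [_ _ few _] := th.
have [disW _ E d2 U] := two_calls_shape th tc.
have d1 := two_calls_missing_neq1 th tc.
have dx : missing_at h x = missing h.
  apply/eqP; rewrite eqEcard missing_at_sub.
  by move: few d1 d2 U; clear; lia.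
set W := known h i1 y1 :\ y1 in disW E W0.
have degW w : w \in W -> 2 < #|calls_of h w|.
  move=> wW; have [xw wx wnx] := known_missing tc wW.
  have wV : w \in V by move: wW; rewrite !inE => /and3P[].
  have dw : #|missing_at h w| <= 1.
    rewrite -(cards1 (x, w)); apply/subset_leq_card/subsetP=> -[a b].
    case/setIdP; rewrite -{1}dx => /setIdP[ab] /= abx abw; rewrite inE.
    have xw' : (x == w) = false by rewrite eq_sym (negbTE wnx).
    case/pred2P: abx ab abw => ->; rewrite ?xw' ?(negbTE wnx) ?orbF /=.
      by move=> _ /eqP->.
    by move=> + /eqP aw; rewrite aw (negbTE wx).
  rewrite ltn_neqAle (two_le_calls_of m5 n5 few wV) andbT eq_sym; apply/eqP.
  move=> /[dup] degw /two_callsP[j1 [z1 [j2 [z2 tcw]]]].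
  have := two_calls_missing_neq1 th tcw; have := missing_at_calls_of h m5 wV.
  by rewrite degw; move: dw; clear; lia.
have := card_calls_meeting tc disW; rewrite -/W.
have [/eqP/cards1P[w WE]|W2] := eqVneq #|W| 1.
  have := degW w; rewrite WE set11 big_set1 cards1 => /(_ isT).
  by move: U d2; clear; lia.
have /cards2P[w [w' [ww' WE]]] : #|W| == 2 by move: W0 W2 E d2; clear; lia.
have := degW w; have := degW w'; rewrite WE !inE !eqxx orbT => /(_ isT) + /(_ isT).
rewrite bigcup_setU !big_set1.
have := cardsUI (calls_of h w) (calls_of h w').
by have := card_common_calls h ww'; rewrite cards2 ww'; move: U d2; clear; lia.
Qed.

End LowDegree.

(** * First and last calls *)

Section Tight.
Variables (T : finType) (V : {set T}) (m : nat).
Implicit Types (h : history V m) (x y z v w : T) (i j k : 'I_m).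

Definition first_of h v j := v \in call h j /\ forall k, before h k j -> v \notin call h k.

Lemma exists_first h v i : v \in call h i -> exists j, first_of h v j.
Proof.
elim: {i}#|[set k | before h k i]| {-2}i (leqnn #|[set k | before h k i]|) => [|d IHd] i.
  rewrite leqn0 cards_eq0 => /eqP i_first vi; exists i; split=> // k ki.
  have : k \in [set k | before h k i] by rewrite inE.
  by rewrite i_first inE.
move=> le_d vi; have [/existsP[k /andP[ki vk]]|] :=
  boolP [exists k, before h k i && (v \in call h k)].
  apply: IHd vk; rewrite -ltnS; apply: leq_trans le_d; apply: proper_card.
  apply/properP; split; last by exists k; rewrite !inE ?ki ?before_irr.
  by apply/subsetP=> l; rewrite !inE => lk; apply: before_trans lk ki.
rewrite negb_exists => /forallP none; exists i; split=> // k ki.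
by have := none k; rewrite ki.
Qed.

Lemma first_before h v i j : first_of h v j -> v \in call h i -> i != j -> before h j i.
Proof.
move=> [vj first] vi ij; have /orP[lt_ij|//] := before_total h ij.
by move/negP: (first i lt_ij).
Qed.

Lemma first_not_last h v j : first_of h v j -> first_of (dual h) v j ->
  #|calls_of h v| <= 1.
Proof.
move=> fj lj; apply/card_le1P => i; rewrite inE => vi k; rewrite !inE.
have only l : v \in call h l -> l = j.
  move=> vl; apply/eqP; apply: contraT => lj'.
  have jl := first_before fj vl lj'; have lj'' := first_before lj vl lj'.
  by have := before_trans jl lj''; rewrite before_irr.
by apply/idP/eqP => [/only->|->//]; rewrite (only _ vi).
Qed.

(** [v] gets the item of [z] in her very first call, from [g]; whatever leaves [v] for [z], in this
    call or later, would take that item back to [z]. *)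
Lemma first_missing h v j g z : first_of h v j -> v \in V -> z \in V ->
  g \in call h j -> g != v -> g \in knows h j z -> z != g ->
  (v, z) \in missing h.
Proof.
move=> fj vV zV gj gv gk zg; have [vj first] := fj.
have vz : v != z.
  apply: contraNneq gv => vz; rewrite -vz in gk.
  by rewrite (noho_knows gk gj vj (flow_self (bwd h) j v)).
rewrite in_missing vV zV /=; apply/negP; rewrite learned_sources => vs.
have [i [p [vi pi pf vf]]] := flow_elimE (bwd h) vs vz.
have [ij|ij] := eqVneq i j; last first.
  have ji := first_before fj vi ij.
  have vk := flow_step (fwd h) ji gj gk vj.
  by rewrite (noho_knows vk vi pi pf) eqxx in vz.
rewrite ij in vi pi pf vf.
have pg : p = g.
  move: pi; rewrite (callE gj vj gv) !inE => /pred2P[]// pv.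
  by rewrite -pv pf in vf.
by rewrite pg in pf; rewrite (noho gk pf) eqxx in zg.
Qed.

(** Being disjoint from all earlier calls means being first for both participants; on [dual h] these
    are the calls that are last for both. *)
Definition firsts h :=
  [set i | [forall j, before h j i ==> [disjoint call h j & call h i]]].
Definition unmatched h := V :\: \bigcup_(i in firsts h) call h i.
Definition mids h := ~: (firsts h :|: firsts (dual h)).

Lemma firsts_first h i v : i \in firsts h -> v \in call h i -> first_of h v i.
Proof.
rewrite inE => /forallP fi vi; split=> // k ki.
by have := fi k; rewrite ki /= disjoint_sym => /disjointFr ->.
Qed.

Lemma notin_firsts h i j v : before h i j -> v \in call h i -> v \in call h j ->
  j \notin firsts h.
Proof.
move=> ij vi vj; apply/negP => /firsts_first/(_ vj)[_ /(_ _ ij)].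
by rewrite vi.
Qed.

Lemma unmatched_shape h v i : v \in unmatched h -> v \in call h i ->
  exists j g k w, [/\ first_of h v j, g \in call h j /\ g != v, before h k j,
    call h k = [set g; w] /\ g != w & (v, w) \in missing h].
Proof.
rewrite inE => /andP[vF vV] /exists_first[j fj]; have [vj _] := fj.
have : j \notin firsts h.
  by apply: contra vF => jF; apply/bigcupP; exists j.
rewrite inE negb_forall => /existsP[k]; rewrite negb_imply => /andP[kj].
case/meetP=> g gk gj.
have gv : g != v.
  by apply: contraTneq gk => ->; have [_ /(_ _ kj)] := fj.
have [w [wg wk kE]] := partner gk.
exists j, g, k, w; split; rewrite // 1?eq_sym //.
have wV : w \in V by apply: (subsetP (call_sub h k)).
apply: first_missing fj vV wV gj gv _ wg.
exact: (flow_step (fwd h) kj wk (flow_self (fwd h) k w) gk).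
Qed.

Lemma unmatched_sub h : (forall v, v \in V -> 0 < #|calls_of h v|) ->
  unmatched h \subset fst @: missing h.
Proof.
move=> deg; apply/subsetP=> v vU.
have /card_gt0P[i] : 0 < #|calls_of h v|.
  by apply: deg; move: vU; rewrite inE => /andP[].
rewrite inE => vi; have [j [g [k [w [_ _ _ _ vw]]]]] := unmatched_shape vU vi.
by apply/imsetP; exists (v, w).
Qed.

Lemma card_unmatched h : (forall v, v \in V -> 0 < #|calls_of h v|) ->
  #|unmatched h| <= #|missing h|.
Proof.
by move=> deg; apply: leq_trans (subset_leq_card (unmatched_sub deg)) (leq_imset_card _ _).
Qed.

Lemma card_firsts h : #|V| <= 2 * #|firsts h| + #|unmatched h|.
Proof.
have -> : #|unmatched h| = #|V| - #|V :&: \bigcup_(i in firsts h) call h i|.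
  by rewrite cardsD.
suff : #|V :&: \bigcup_(i in firsts h) call h i| <= 2 * #|firsts h| by clear; lia.
apply: leq_trans (subset_leq_card (subsetIr _ _)) _.
rewrite mulnC -sum_nat_const; elim/big_rec2: _ => [|i n A iF le]; first by rewrite cards0.
by apply: leq_trans (leq_card_setU _ _) _; rewrite card_call leq_add2l.
Qed.

(** Calls first for both cover the matched people two at a time, and likewise calls last for both.
    The families are disjoint, as a common call would be the only call of its participants. *)
Lemma card_mids h : (forall v, v \in V -> 1 < #|calls_of h v|) ->
  2 * #|mids h| + 2 * #|V| <= 2 * m + #|unmatched h| + #|unmatched (dual h)|.
Proof.
move=> deg; have := card_firsts h; have := card_firsts (dual h).
have := cardsC (firsts h :|: firsts (dual h)); rewrite card_ord -/(mids h).
have := cardsUI (firsts h) (firsts (dual h)).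
rewrite [_ :&: _](_ : _ = set0) ?cards0; first by clear; lia.
apply/setP=> i; rewrite in_setI in_set0; apply/negP => /andP[iF iL].
have /eqP/cards2P[a [b [ab iE]]] := card_call h i.
have ai : a \in call h i by rewrite iE !inE eqxx.
have aV : a \in V by apply: (subsetP (call_sub h i)).
have := first_not_last (firsts_first iF ai) (firsts_first iL ai).
by rewrite leqNgt deg.
Qed.

(** * A person without useless calls *)

Definition good h x := [/\ x \in V, useless h x = set0, #|calls_of h x| = 3 &
  forall z, z \in V -> z \in learned h x /\ z \in sources h x].

Lemma useless_dual h x : useless (dual h) x = useless h x.
Proof. by rewrite /useless setUC. Qed.

Lemma good_dual h x : good h x -> good (dual h) x.
Proof. by case=> xV U C A; split; rewrite ?useless_dual // => z /A[]. Qed.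

(** If [#|missing_at h x| + #|calls_of h x|] were at least 4 for everybody, then
    [4 * #|V| <= 2 * #|missing h| + 2 * m], while [2 * m = 4 * #|V| - 10] and at most two pairs are
    missing. *)
Lemma exists_good h : tight h -> exists x, good h x.
Proof.
case=> m5 n5 few del; have th : tight h by [].
have [/existsP[x /andP[xV small]]|] :=
    boolP [exists x, (x \in V) && (#|missing_at h x| + #|calls_of h x| <= 3)].
  have d3 := two_lt_calls_of th xV; have dU := missing_at_calls_of h m5 xV.
  have C : #|calls_of h x| = 3 by move: d3 small; clear; lia.
  have U : useless h x = set0.
    by apply/eqP; rewrite -cards_eq0; move: small dU; clear; lia.
  have M : missing_at h x = set0.
    by apply/eqP; rewrite -cards_eq0; move: C small; clear; lia.
  exists x; split=> // z zV; split.
    apply: contraT => xz; have : (x, z) \in missing_at h x.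
      by rewrite /missing_at in_set in_missing xV zV xz eqxx.
    by rewrite M inE.
  rewrite -learned_sources; apply: contraT => zx.
  have : (z, x) \in missing_at h x.
    by rewrite /missing_at in_set in_missing xV zV zx eqxx orbT.
  by rewrite M inE.
rewrite negb_exists => /forallP big.
have : \sum_(x in V) 4 <= \sum_(x in V) (#|missing_at h x| + #|calls_of h x|).
  by apply: leq_sum => x xV; have := big x; rewrite xV /= -ltnNge.
rewrite big_split /= sum_calls_of sum_nat_const; have := sum_missing_at h.
set S := \sum_(x in V) _; move: few m5; move: S #|missing h| #|V|; clear; lia.
Qed.

Definition lonely h x := [set z in V :\ x | [disjoint calls_of h z & calls_of h x]].
Definition told h x := [set z in lonely h x | 1 < #|calls_of h z :&: tells h x|].

(** The call in which [z] learns the item of [x] lies strictly between other calls of [z]: an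
    I-useful one, which would return the item to [x] if it came later, and her second O-useful one,
    which cannot come earlier. *)
Lemma card_told h x : good h x ->
  #|told h x| <= #|mids h :&: (tells h x :\: calls_of h x)|.
Proof.
case=> xV U C A; apply: leq_trans (leq_imset_card (learner h x) _).
apply/subset_leq_card/subsetP=> z /setIdP[/setIdP[/setD1P[zx zV] lon] two].
have [zl zs] := A z zV.
have [i [y [zi yi yk zk]]] := flow_elimE (fwd h) zl zx.
have [i' [y' [zi' yi' yf' zf']]] := flow_elimE (bwd h) zs zx.
have iO := tells_intro yi yk zi zk.
have iI' : i' \in tells (dual h) x by exact: (tells_intro (h := dual h) yi' yf' zi' zf').
have iC : i \notin calls_of h x by rewrite (disjointFr lon) // inE.
apply/imsetP; exists i; last by rewrite (learner_eq iO zi zk).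
rewrite in_setI in_setD iC iO !andbT /mids in_setC in_setU negb_or; apply/andP; split.
  have i'i : i' != i.
    by apply: contraNneq iC => ii; rewrite -tellsI in_setI iO /= -ii.
  have /orP[lt_i|lt_i] := before_total h i'i.
    exact: notin_firsts lt_i zi' zi.
  have zk' := tells_after iO lt_i zi.
  by rewrite (noho_knows zk' zi' yi' yf') eqxx in zx.
have : 0 < #|(calls_of h z :&: tells h x) :\ i|.
  by have := cardsD1 i (calls_of h z :&: tells h x); move: two; case: (_ \in _); clear; lia.
case/card_gt0P=> k /setD1P[ki /setIP[]].
rewrite inE => zk1 kO; have /orP[lt_k|lt_k] := before_total h ki.
  by rewrite (tells_after kO lt_k zk1) in zk.
exact: (@notin_firsts (dual h) k i z lt_k zk1 zi).
Qed.

Lemma mids_dual h : mids (dual h) = mids h.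
Proof. by rewrite /mids setUC. Qed.

(** All but [x] and her at most three partners are lonely. Each lonely person has at least three
    calls, each useful in exactly one direction, so she is told in one direction. The middle call of
    [x] is one more member of [mids]. *)
Lemma mids_lower_bound h x : good h x -> (forall v, v \in V -> 2 < #|calls_of h v|) ->
  #|V| + #|told h x :&: told (dual h) x| <= #|mids h| + 3.
Proof.
move=> gx deg; have [xV U C A] := gx.
have lonE : lonely (dual h) x = lonely h x by [].
have sub : lonely h x \subset told h x :|: told (dual h) x.
  apply/subsetP=> z zl; rewrite in_setU ![_ \in told _ _]in_set.
  have zlon := zl; move/setIdP: zl => [/setD1P[zx zV] lon].
  rewrite lonE zlon /=.
  have := cardsUI (calls_of h z :&: tells h x) (calls_of h z :&: tells (dual h) x).
  rewrite -setIUr; have -> : tells h x :|: tells (dual h) x = setT.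
    by rewrite -[LHS]setCK -/(useless h x) U setC0.
  rewrite setIT; have := deg z zV; move=> d3.
  rewrite setIACA setIid tellsI (disjoint_setI0 lon) cards0.
  rewrite -implyNb -leqNgt addn0 => E; apply/implyP => le1.
  change (1 < #|calls_of h z :&: tells (dual h) x|); move: d3.
  rewrite E => lt2; rewrite -(ltn_add2l 1); apply: leq_trans lt2 _.
  by rewrite leq_add2r.
have lon4 : #|V| <= #|lonely h x| + 4.
  have : V \subset lonely h x :|: (x |: \bigcup_(i in calls_of h x) (call h i :\ x)).
    apply/subsetP=> z zV; rewrite in_setU; have [//|] := boolP (z \in lonely h x).
    rewrite inE in_setD1 zV andbT negb_and negbK !inE /=.
    have [//|zx /=] := eqVneq z x.
    case/meetP=> i; rewrite inE => zi xi; apply/bigcupP; exists i => //.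
    by rewrite !inE zx.
  move/subset_leq_card/leq_trans; apply; apply: leq_trans (leq_card_setU _ _) _.
  rewrite leq_add2l; apply: leq_trans (leq_card_setU _ _) _; rewrite cards1 ltnS -C.
  rewrite -[#|calls_of h x|]sum1_card; elim/big_rec2: _ => [|i n B iC le]; first by rewrite cards0.
  apply: leq_trans (leq_card_setU _ _) _; apply: leq_add => //.
  have := cardsD1 x (call h i); rewrite card_call.
  by move: iC; rewrite inE => ->; clear; lia.
have mid : 0 < #|mids h :&: calls_of h x|.
  have /card_gt0P[i] : 0 < #|calls_of h x| by rewrite C.
  rewrite inE => xi; have [j fj] := exists_first xi.
  have [j' fj'] := @exists_first (dual h) x i xi.
  have : 0 < #|calls_of h x :\: [set j; j']|.
    rewrite cardsD C; have := subset_leq_card (subsetIr (calls_of h x) [set j; j']).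
    by rewrite cards2; case: (_ == _); clear; lia.
  case/card_gt0P=> k; rewrite !inE negb_or => /andP[/andP[kj kj'] xk].
  apply/card_gt0P; exists k; rewrite in_setI in_setC in_setU negb_or [k \in calls_of _ _]inE xk andbT.
  have [[xj _] [xj' _]] := (fj, fj').
  rewrite (notin_firsts (first_before fj xk kj) xj xk) /=.
  exact: (@notin_firsts (dual h) j' k x (first_before fj' xk kj') xj' xk).
have t1 := card_told gx; have t2 := card_told (good_dual gx).
rewrite mids_dual in t2.
have := cardsUI (told h x) (told (dual h) x); have := subset_leq_card sub.
suff : #|mids h :&: (tells h x :\: calls_of h x)| +
  #|mids h :&: (tells (dual h) x :\: calls_of (dual h) x)| + #|mids h :&: calls_of h x|
  <= #|mids h| by move: lon4 mid t1 t2; clear; lia.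
have disj : (tells h x :\: calls_of h x) :&: (tells (dual h) x :\: calls_of (dual h) x) = set0.
  apply/setP=> i; rewrite in_set0; apply/negP => /setIP[/setDP[iO iC] /setDP[iI _]].
  by case/negP: iC; rewrite -tellsI in_setI iO.
rewrite -(cardsID (calls_of h x) (mids h)) addnC leq_add2l.
rewrite -cardsUI -setIIr disj setI0 cards0 addn0 -setIUr.
apply/subset_leq_card/subsetP=> i /setIP[iM /setUP[]/setDP[_ iC]]; exact/setDP.
Qed.

End Tight.

(** * Opposite corners *)

Section Corner.
Variables (T : finType) (V : {set T}) (m : nat).
Implicit Types (h : history V m) (x y z u v w a b : T) (i j k : 'I_m).

(** The surroundings of a missing pair [(a, b)]: [y] starts with [b] and in her next call takes that
    item straight to [a]. *)
Record corner h a b k j y : Prop := Corner {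
  corner_before : before h k j;
  corner_k : call h k = [set y; b];
  corner_j : call h j = [set y; a];
  corner_yb : y != b;
  corner_ya : y != a;
  corner_a : first_of h a j;
  corner_b : first_of h b k;
  corner_y : forall i, y \in call h i -> before h i j -> i = k
}.

Lemma corner_first_y h a b k j y : corner h a b k j y -> first_of h y k.
Proof.
move=> c; split; first by rewrite (corner_k c) !inE eqxx.
move=> i ik; apply/negP => yi.
have ij := before_trans ik (corner_before c).
by move: ik; rewrite (corner_y c yi ij) before_irr.
Qed.

(** The only case that the two estimates of [mids] leave open: the unmatched people are exactly the
    starts, respectively the ends, of the missing pairs, without repetition. *)
Definition extremal h := [/\ tight h, #|unmatched h| = #|missing h| &
  #|unmatched (dual h)| = #|missing h|].

Lemma extremal_dual h : extremal h -> extremal (dual h).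
Proof. by case=> /tight_dual ? E1 E2; split; rewrite // card_missing_dual. Qed.

Lemma extremal_calls_of h v : extremal h -> v \in V -> 2 < #|calls_of h v|.
Proof. by case=> th _ _; apply: two_lt_calls_of. Qed.

Lemma extremal_unmatched h : extremal h ->
  unmatched h = fst @: missing h /\ {in missing h &, injective fst}.
Proof.
move=> eh; have [th E _] := eh.
have sub : unmatched h \subset fst @: missing h.
  by apply: unmatched_sub => v /(extremal_calls_of eh); apply: leq_trans.
split; first by apply/eqP; rewrite eqEcard sub E leq_imset_card.
apply/imset_injP; rewrite eqn_leq leq_imset_card /= -E.
exact: subset_leq_card.
Qed.

(** [a] starts no second missing pair, so by [first_missing] her first partner [y] knows before [j]
    only her own item and that of [b]. *)
Lemma exists_corner h a b : extremal h -> (a, b) \in missing h ->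
  exists k j y, corner h a b k j y.
Proof.
move=> eh ab; have [unE inj] := extremal_unmatched eh.
have := ab; rewrite in_missing => /and3P[aV bV nab].
have /card_gt0P[i] : 0 < #|calls_of h a|.
  by apply: leq_trans (extremal_calls_of eh aV).
rewrite inE => ai; have aU : a \in unmatched h by rewrite unE; apply/imsetP; exists (a, b).
have [j [y [k [w [fj [yj ya] kj [kE yw] aw]]]]] := unmatched_shape aU ai.
have only c : (a, c) \in missing h -> c = b.
  by move=> ac; have [] := inj _ _ ac ab erefl.
have wb := only _ aw; rewrite wb in kE yw.
have toward c : y \in knows h j c -> c \in V -> c != y -> c = b.
  by move=> yk cV cy; apply: only; apply: first_missing yj ya yk cy.
have yk : y \in call h k by rewrite kE !inE eqxx.
have bk : b \in call h k by rewrite kE !inE eqxx orbT.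
have [aj _] := fj.
exists k, j, y; split=> //; first by rewrite (callE yj aj ya).
- split=> // l lk; apply/negP => bl; have [c [cb cl lE]] := partner bl.
  have cV : c \in V by apply: (subsetP (call_sub h l)).
  have bkc := flow_step (fwd h) lk cl (flow_self (fwd h) l c) bl.
  have ykc := flow_step (fwd h) kj bk bkc yk.
  have [cy|cy] := eqVneq c y; last by rewrite (toward c) ?eqxx // in cb.
  have lk' : l = k by apply: (@call_inj _ _ _ h); rewrite lE kE cy setUC.
  by move: lk; rewrite lk' before_irr.
move=> l yl lj; have [c [cy cl lE]] := partner yl.
have cV : c \in V by apply: (subsetP (call_sub h l)).
have ykc := flow_step (fwd h) lj cl (flow_self (fwd h) l c) yl.
by apply: (@call_inj _ _ _ h); rewrite lE kE (toward c).
Qed.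

(* In a pair of opposite corners the last call of the one closes a cycle with
   the first call of the other, so it carries nothing new about [y]. *)
Lemma corner_useless h a b k j y k' j' u : extremal h -> a \in V -> b \in V ->
  corner h a b k j y -> corner (dual h) b a k' j' u -> k' \in useless h y.
Proof.
move=> eh aV bV c c'; have degb := extremal_calls_of eh bV.
have kj' : k != j'.
  apply: contraTneq degb => kE; rewrite -leqNgt.
  have fb := corner_b c; rewrite kE in fb.
  by apply: ltnW; apply: first_not_last fb (corner_a c').
have jE' : call h j' = [set u; b] := corner_j c'.
have kE' : call h k' = [set u; a] := corner_k c'.
have uy : u != y.
  apply: contraNneq kj' => uy; apply/eqP; apply: (@call_inj _ _ _ h).
  by rewrite (corner_k c) jE' uy.
have aj : a \in call h j by rewrite (corner_j c) !inE eqxx orbT.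
have yj : y \in call h j by rewrite (corner_j c) !inE eqxx.
have ak' : a \in call h k' by rewrite kE' !inE eqxx orbT.
have bj' : b \in call h j' by rewrite jE' !inE eqxx orbT.
have uj' : u \in call h j' by rewrite jE' !inE eqxx.
have bk : b \in call h k by rewrite (corner_k c) !inE eqxx orbT.
have yk : y \in call h k by rewrite (corner_k c) !inE eqxx.
have kj1 : k' != j.
  apply: contraNneq uy => kE; have : u \in call h j by rewrite -kE kE' !inE eqxx.
  rewrite (corner_j c) !inE => /pred2P[->|uE]; first by rewrite eqxx.
  by have := corner_yb c'; rewrite uE eqxx.
have jk' := first_before (corner_a c) ak' kj1.
have kj2 : before h k j' by apply: first_before (corner_b c) bj' _; rewrite eq_sym.
have j'k' : before h j' k' := corner_before c'.
have bkn := flow_step (fwd h) kj2 yk (flow_self (fwd h) k y) bk.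
have ukn := flow_step (fwd h) j'k' bj' bkn uj'.
have akn := flow_step (fwd h) jk' yj (flow_self (fwd h) j y) aj.
have sub p : p \in call h k' -> p \in knows h k' y.
  by rewrite kE' !inE => /pred2P[]->.
rewrite /useless in_setC in_setU negb_or; apply/andP; split; apply/negP.
  case/tells_elim=> p [q [E _ _ qk]]; move/negP: qk; apply; apply: sub.
  by rewrite E !inE eqxx orbT.
case/tells_elim=> p [q [E _ pf _]]; have pk : p \in call h k'.
  by rewrite [call _ _]E !inE eqxx.
have py := noho (sub p pk) pf; move: pk; rewrite py kE' !inE eq_sym (negbTE uy).
by rewrite (negbTE (corner_ya c)).
Qed.

(** Nobody in [k] or [j] knows the item of [x] beforehand, so both calls are I-useful. Because of
    [j], [y] still reaches [x] after [k]; hence [b] does not, and no other call of [b] is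
    I-useful. *)
Lemma corner_tells h x a b : extremal h -> good h x -> (a, b) \in missing h ->
  exists k j y, [/\ corner h a b k j y, useless h y != set0,
    [/\ x != y, x != a & x != b], k \in tells (dual h) x &
    forall i, b \in call h i -> i != k -> i \notin tells (dual h) x].
Proof.
move=> eh gx ab; have [xV U C A] := gx.
have := ab; rewrite in_missing => /and3P[aV bV nab].
have [k [j [y c]]] := exists_corner eh ab.
have [|k' [j' [u c']]] := @exists_corner (dual h) b a (extremal_dual eh).
  by rewrite missing_dual.
have uy : useless h y != set0.
  by apply/set0Pn; exists k'; apply: corner_useless eh aV bV c c'.
have xy : x != y by apply: contraNneq uy => <-; rewrite U.
have xa : x != a by apply: contraNneq nab => <-; have [] := A b bV.
have xb : x != b by apply: contraNneq nab => xb; rewrite learned_sources -xb; have [] := A a aV.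
have either i : i \notin tells h x -> i \in tells (dual h) x.
  move=> nO; have : i \notin useless h x by rewrite U inE.
  by rewrite /useless in_setC negbK in_setU (negbTE nO).
have fy := corner_first_y c.
have kx e : e \in call h k -> e \notin knows h k x.
  rewrite (corner_k c) !inE => /pred2P[]->; apply/negP => ek.
    have [|i [p [ik yi _ _ _]]] := flow_elim (fwd h) ek; first by rewrite eq_sym.
    by have [_ /(_ _ ik)/negP] := fy.
  have [|i [p [ik bi _ _ _]]] := flow_elim (fwd h) ek; first by rewrite eq_sym.
  by have [_ /(_ _ ik)/negP] := corner_b c.
have kI : k \in tells (dual h) x.
  apply: either; apply/negP => /tells_elim[p [q [E _ pk _]]].
  by have := kx p; rewrite E !inE eqxx => /(_ isT)/negP.
have yk : y \in call h k by rewrite (corner_k c) !inE eqxx.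
have bk : b \in call h k by rewrite (corner_k c) !inE eqxx orbT.
have yj : y \in call h j by rewrite (corner_j c) !inE eqxx.
have yf : y \in feeds h k x.
  apply: contraT => nyf; have jO : j \in tells h x.
    apply: contraT => /either jI.
    by have := tells_after (h := dual h) jI (corner_before c) yj; rewrite /= (negbTE nyf).
  have [p [q [E _ pk _]]] := tells_elim jO.
  have pj : p \in [set y; a] by rewrite -(corner_j c) E !inE eqxx.
  move: pj pk; rewrite !inE => /pred2P[]-> pk.
    have [|i [r [ij yi ri rk _]]] := flow_elim (fwd h) pk; first by rewrite eq_sym.
    have ik := corner_y c yi ij; rewrite ik in ri rk.
    by rewrite (negbTE (kx r ri)) in rk.
  have [|i [r [ij ai _ _ _]]] := flow_elim (fwd h) pk; first by rewrite eq_sym.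
  by have [_ /(_ _ ij)/negP] := corner_a c.
have bf : b \notin feeds h k x.
  exact: (tells_notsub (h := dual h) kI yk bk (corner_yb c) yf).
exists k, j, y; split=> // i bi ik; apply: contra bf => iI.
exact: (tells_after (h := dual h) iI (first_before (corner_b c) bi ik) bi).
Qed.

(** By [corner_tells] in both directions of time, [k] and [j] are the only I-useful calls of [y]. A
    call useless for [y] forces her to have a fourth call, so at least two are O-useful: [y] is told
    in both directions, which [mids_lower_bound] excludes. *)
Lemma not_extremal h : extremal h -> 0 < #|missing h| ->
  #|mids h| + 3 <= #|V| -> False.
Proof.
move=> eh /card_gt0P[[a b] ab] few_mids.
have [th unE unE'] := eh; have [m5 n5 few del] := th.
have [x gx] := exists_good th; have [xV U C A] := gx.
have deg := fun v => extremal_calls_of (v := v) eh.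
have := ab; rewrite in_missing => /and3P[aV bV nab].
have [k [j [y [c uy [xy xa xb] kI bI]]]] := corner_tells eh gx ab.
have [|k' [j' [u [c' _ _ kO' aO]]]] :=
  @corner_tells (dual h) x b a (extremal_dual eh) (good_dual gx).
  by rewrite missing_dual.
have either i : i \notin tells h x -> i \in tells (dual h) x.
  move=> nO; have : i \notin useless h x by rewrite U inE.
  by rewrite /useless in_setC negbK in_setU (negbTE nO).
have fa := corner_a c; have la : first_of (dual h) a k' := corner_b c'.
have jk' : j != k'.
  apply: contraTneq (deg _ aV) => jE; rewrite -leqNgt; apply: ltnW.
  by rewrite -jE in la; apply: first_not_last fa la.
have [aj _] := fa.
have jI : j \in tells (dual h) x by apply: either; apply: aO.
have yj : y \in call h j by rewrite (corner_j c) !inE eqxx.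
have yk : y \in call h k by rewrite (corner_k c) !inE eqxx.
have yV : y \in V by apply: (subsetP (call_sub h j)).
have kj : k != j by apply: contraTneq (corner_before c) => ->; rewrite before_irr.
(* A third call of [a], besides her first and last, is I-useful and comes after [j]. *)
have af : a \in feeds h j x.
  have : 0 < #|calls_of h a :\: [set j; k']|.
    have := cardsID [set j; k'] (calls_of h a); have := deg _ aV.
    have := subset_leq_card (subsetIr (calls_of h a) [set j; k']).
    by rewrite cards2; case: (_ == _); clear; lia.
  case/card_gt0P=> i; rewrite !inE negb_or => /andP[/andP[ij ik'] ai].
  have iI : i \in tells (dual h) x by apply: either; apply: aO.
  exact: (tells_after (h := dual h) iI (first_before fa ai ij) ai).
have yf : y \notin feeds h j x.
  by apply: (tells_notsub (h := dual h) jI aj yj _ af); rewrite eq_sym (corner_ya c).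
have yI i : y \in call h i -> i \in tells (dual h) x -> i \in [set k; j].
  move=> yi iI; rewrite !inE; have [//|ij] := eqVneq i j; first by rewrite orbT.
  have /orP[lt_ij|lt_ji] := before_total h ij; first by rewrite (corner_y c yi lt_ij) eqxx.
  by case/negP: yf; apply: (tells_after (h := dual h) iI lt_ji yi).
have kF : k \in firsts h.
  rewrite inE; apply/forallP=> i; apply/implyP=> ik; apply/pred0P => e /=.
  apply/negP => /andP[ei]; rewrite (corner_k c) !inE => /pred2P[] eE; move: ei; rewrite eE.
    by have [_ /(_ _ ik)/negP] := corner_first_y c.
  by have [_ /(_ _ ik)/negP] := corner_b c.
(* [y] starts no missing pair, as [k] is first for both participants; if she ended one,
   [corner_tells] would allow her only one I-useful call. *)
have dy : missing_at h y = set0.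
  apply/setP=> -[p q]; rewrite in_set0; apply/negP => /setIdP[pq] /= /pred2P[pE|qE].
    have : y \in unmatched h.
      have [-> _] := extremal_unmatched eh; apply/imsetP.
      by exists (p, q) => //=.
    by rewrite inE => /andP[/bigcupP[]]; exists k.
  rewrite qE in pq; have [k2 [_ [_ [_ _ _ _ yO]]]] := corner_tells eh gx pq.
  have [jk2|jk2] := eqVneq j k2; last by have := yO j yj jk2; rewrite jI.
  by have := yO k yk; rewrite -jk2 kj kI => /(_ isT).
have degy : 3 < #|calls_of h y|.
  have := missing_at_calls_of h m5 yV; rewrite dy cards0.
  by move: uy; rewrite -cards_eq0; clear; lia.
have ylon : y \in lonely h x.
  apply/setIdP; split; first by rewrite !inE eq_sym xy.
  apply/pred0P => i /=; apply/negP => /andP[]; rewrite !inE => yi xi.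
  have := yI i yi; rewrite (tells_own (h := dual h)) // => /(_ isT).
  move: xi => /[swap]; rewrite !inE => /pred2P[]->.
    by rewrite (corner_k c) !inE (negbTE xy) (negbTE xb).
  by rewrite (corner_j c) !inE (negbTE xy) (negbTE xa).
have yIc : calls_of h y :&: tells (dual h) x = [set k; j].
  apply/setP=> i; rewrite in_setI [i \in calls_of _ _]inE; apply/andP/idP.
    by case=> yi; apply: yI.
  by rewrite !in_set2 => /pred2P[]->.
have told_y : y \in told h x :&: told (dual h) x.
  rewrite in_setI; apply/andP; split; apply/setIdP; split=> //.
    have := cardsID (tells (dual h) x) (calls_of h y); rewrite yIc cards2 kj.
    have : #|calls_of h y :\: tells (dual h) x| <= #|calls_of h y :&: tells h x|.
      apply/subset_leq_card/subsetP=> i /setDP[iy iI]; rewrite in_setI iy.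
      by apply: contraR iI; apply: either.
    by move: degy; clear; lia.
  by rewrite [X in 1 < #|pred_of_set X|]yIc cards2 kj.
have := mids_lower_bound gx deg.
have : 0 < #|told h x :&: told (dual h) x| by apply/card_gt0P; exists y.
by move: few_mids; clear; lia.
Qed.

Lemma missing_ge3 h : m + 5 = 2 * #|V| -> 4 < #|V| -> deletable h ->
  2 < #|missing h|.
Proof.
move=> m5 n5 del; rewrite ltnNge; apply/negP => few.
have th : tight h by [].
have deg v := two_lt_calls_of (x := v) th.
have [x gx] := exists_good th.
have low := mids_lower_bound gx deg.
have deg1 v : v \in V -> 1 < #|calls_of h v| by move/deg/ltnW.
have deg0 v : v \in V -> 0 < #|calls_of h v| by move/deg1/ltnW.
have up := card_mids deg1; have u1 := card_unmatched deg0.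
have u2 := @card_unmatched _ _ _ (dual h) deg0; rewrite card_missing_dual in u2.
(* From [#|V| <= #|mids h| + 3] and [#|mids h| + 5 <= #|V| + #|missing h|] there are two missing
   pairs, with equality throughout. *)
have eh : extremal h by split=> //; move: m5 few low up u1 u2; clear; lia.
by apply: (not_extremal eh); move: m5 few low up u1 u2; clear; lia.
Qed.

End Corner.

(** * Histories of call sequences *)

Section Sequences.
Variable T : finType.
Implicit Types (A B c V : {set T}) (s p : seq {set T}) (x y z a b : T).

Lemma spread_takeS s i A : i < size s ->
  spread (take i.+1 s) A = step (spread (take i s) A) (nth set0 s i).
Proof. by move=> lt_i; rewrite (take_nth set0 lt_i) spread_rcons. Qed.

Lemma spread_take_sub s i j A : i <= j -> spread (take i s) A \subset spread (take j s) A.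
Proof.
move=> le_ij; rewrite -(cat_take_drop i (take j s)) take_takel // spread_cat.
exact: sub_spread.
Qed.

Lemma spread_take_elim s j x z : j <= size s ->
  z \in spread (take j s) [set x] -> z != x -> exists i y,
  [/\ i < j, z \in nth set0 s i, y \in nth set0 s i,
      y \in spread (take i s) [set x] & z \notin spread (take i s) [set x]].
Proof.
elim: j => [_|j IHj lt_j]; first by rewrite take0 inE => ->.
move=> zs zx; have [zj|nzj] := boolP (z \in spread (take j s) [set x]).
  have [i [y [ij ? ? ? ?]]] := IHj (ltnW lt_j) zj zx.
  by exists i, y; split=> //; apply: ltnW.
move: zs; rewrite spread_takeS // in_step (negbTE nzj) /= => /andP[zc /meetP[y ys yc]].
by exists j, y.
Qed.

Lemma seq_flow m s : size s = m ->
  flow (fun i : 'I_m => nth set0 s i) (fun i j : 'I_m => i < j)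
    (fun (i : 'I_m) x => spread (take i s) [set x]) (fun x => spread s [set x]).
Proof.
move=> sm.
have stepP i x y z : i < m -> y \in nth set0 s i -> y \in spread (take i s) [set x] ->
    z \in nth set0 s i -> z \in spread (take i.+1 s) [set x].
  move=> lt_i yi yk zi; rewrite spread_takeS ?sm // in_step zi; apply/orP; right.
  by apply/meetP; exists y.
have full x : spread s [set x] = spread (take m s) [set x] by rewrite -sm take_size.
split.
- by move=> i x; apply: spread_self.
- by move=> x; apply: spread_self.
- move=> i j x y z ij yi yk zi; apply: (subsetP (spread_take_sub s [set x] ij)).
  exact: (stepP _ _ _ _ (ltn_ord i) yi yk zi).
- by move=> i j x z ij; apply: (subsetP (spread_take_sub s [set x] (ltnW ij))).
- move=> j x z zk zx.
  have [|i [y [ij ? ? ? ?]]] := spread_take_elim _ zk zx; first by rewrite sm ltnW.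
  by exists (Ordinal (ltn_trans ij (ltn_ord j))), y.
- move=> i x y z yi yk zi; rewrite full.
  by apply: (subsetP (spread_take_sub s [set x] (ltn_ord i))); exact: (stepP _ _ _ _ (ltn_ord i) yi yk zi).
move=> x z; rewrite full => zk zx.
have [|i [y [ij ? ? ? ?]]] := spread_take_elim _ zk zx; first by rewrite sm.
by exists (Ordinal ij), y.
Qed.

(** Serves to renumber the forward flow of [rev s] by [rev_ord] into the backward flow of [s]. *)
Lemma flow_reindex (I : finType) (c c' : I -> {set T}) (lt lt' : rel I) K K' E
    (f : I -> I) : involutive f ->
    (forall i, c' i = c (f i)) -> (forall i j, lt' i j = lt (f i) (f j)) ->
    (forall i x, K' i x = K (f i) x) ->
  flow c lt K E -> flow c' lt' K' E.
Proof.
move=> fK cE ltE KE [s1 s2 s3 s4 s5 s6 s7]; split.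
- by move=> i x; rewrite KE.
- exact: s2.
- by move=> i j x y z; rewrite ltE !cE !KE; apply: s3.
- by move=> i j x z; rewrite ltE !KE; apply: s4.
- move=> j x z; rewrite KE => zk zx; have [i [y [ij ? ? ? ?]]] := s5 _ _ _ zk zx.
  by exists (f i), y; rewrite ltE cE KE fK.
- by move=> i x y z; rewrite cE KE; apply: s6.
move=> x z zk zx; have [i [y [? ? ? ?]]] := s7 _ _ zk zx.
by exists (f i), y; rewrite cE KE fK.
Qed.

Lemma seq_flow_rev m s : size s = m ->
  flow (fun i : 'I_m => nth set0 s i) (fun i j : 'I_m => j < i)
    (fun (i : 'I_m) x => spread (rev (drop i.+1 s)) [set x])
    (fun x => spread (rev s) [set x]).
Proof.
move=> sm; have srm : size (rev s) = m by rewrite size_rev.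
apply: (flow_reindex (@rev_ordK m) _ _ _ (seq_flow srm)) => [i|i j|i x] /=.
- rewrite nth_rev sm; last by rewrite -subSn // leq_subLR; case: (i) => /= ? ?; lia.
  by congr nth; case: (i) => /= ? ?; lia.
- by case: i j => [i lt_i] [j lt_j] /=; lia.
by rewrite rev_drop sm.
Qed.

(** A decidable form of nobody hearing her own item: for no cut [t] does an item move to somebody
    else before [t] and return after it. *)
Definition noho_seq s := [forall t : 'I_(size s).+1, forall x, forall z,
  (z \in spread (take t s) [set x]) ==> (x \in spread (drop t s) [set z]) ==> (z == x)].

Lemma noho_seqP s : noho_seq s -> forall t x z, t <= size s ->
  z \in spread (take t s) [set x] -> z \in spread (rev (drop t s)) [set x] -> z = x.
Proof.
move=> ns t x z le_t zk; rewrite in_spread_rev revK => xf.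
move/forallP/(_ (Ordinal (le_t : t < (size s).+1)))/forallP/(_ x)/forallP/(_ z): ns.
by rewrite /= zk xf => /eqP.
Qed.

Lemma calls_nth V s i : calls V s -> i < size s ->
  #|nth set0 s i| = 2 /\ nth set0 s i \subset V.
Proof. by move=> sV lt_i; have /andP[/eqP] := allP sV _ (mem_nth set0 lt_i). Qed.

Lemma ord_lt_size m s : size s = m -> forall i : 'I_m, i < size s.
Proof. by move=> -> i. Qed.

Definition seq_history V m s (sm : size s = m) (sV : calls V s) (ns : noho_seq s) :
  history V m.
Proof.
refine (@History T V m (fun i => nth set0 s i) (fun i j => i < j)
  (fun i x => spread (take i s) [set x])
  (fun i x => spread (rev (drop i.+1 s)) [set x])
  (fun x => spread s [set x]) (fun x => spread (rev s) [set x])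
  _ _ _ _ _ _ _ _ (seq_flow sm) (seq_flow_rev sm) _ _ _).
- by move=> i; case: (calls_nth sV (ord_lt_size sm i)).
- by move=> i; case: (calls_nth sV (ord_lt_size sm i)).
- by move=> i; rewrite /= ltnn.
- by move=> j i k; apply: ltn_trans.
- by move=> i j; rewrite neq_ltn.
- by move=> x z; apply: in_spread_rev.
- by move=> x; apply: calls_spread.
- move=> x xV; apply: calls_spread => //; by rewrite /calls all_rev.
- move=> i x z zk zf; apply: (noho_seqP ns _ _ zf); first exact: (ord_lt_size sm).
  exact: (subsetP (spread_take_sub s [set x] (leqnSn i))).
- move=> i x y z zk zi yi yf; apply: (noho_seqP ns (ltnW (ord_lt_size sm i)) zk).
  rewrite (drop_nth set0 (ord_lt_size sm i)) rev_cons spread_rcons in_step zi.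
  by apply/orP; right; apply/meetP; exists y.
move=> i x y z zf zi yi yk; apply: (noho_seqP ns (ord_lt_size sm i) _ zf).
rewrite (spread_takeS _ (ord_lt_size sm i)) in_step zi.
by apply/orP; right; apply/meetP; exists y.
Defined.

(** * Deleting the two calls of one person *)

Lemma spread_alone p x : all (fun c : {set T} => x \notin c) p ->
  spread p [set x] = [set x].
Proof.
elim: p => //= c p IHp /andP[xc xp].
by rewrite /step disjoints1 xc IHp.
Qed.

(** The calls of [x] matter for [a] and [b] only if the item enters [x] from [y1] and leaves to
    [y2], who lacks it, while [y1] has no other way to [b]. *)
Lemma spread_two_calls_deleted p1 p2 p3 x y1 y2 a b :
    all (fun c : {set T} => x \notin c) (p1 ++ p2 ++ p3) ->
    a != x -> b != x -> x != y1 -> x != y2 ->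
    b \in spread (p1 ++ [set x; y1] :: p2 ++ [set x; y2] :: p3) [set a] ->
    b \notin spread (p1 ++ p2 ++ p3) [set a] ->
  [/\ y1 \in spread p1 [set a],
      y2 \notin spread (p1 ++ [set x; y1] :: p2) [set a],
      b \in spread p3 [set y2] &
      b \notin spread (p2 ++ [set x; y2] :: p3) [set y1]].
Proof.
rewrite !all_cat => /and3P[x1 x2 x3] ax bx n1 n2.
rewrite !spread_cat /= !spread_cat /=.
set A := spread p1 _; set P := spread p2 A; set R := spread p2 [set y1].
have xA : x \notin A by rewrite /A spread_avoid // inE eq_sym.
have xP : x \notin P by rewrite /P spread_avoid.
have xR : x \notin R by rewrite /R spread_avoid // inE.
have disj (B : {set T}) y : x \notin B -> [disjoint B & [set x; y]] = (y \notin B).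
  by move=> xB; rewrite disjoint_sym disjointUl !disjoints1 xB.
have addx p (B : {set T}) : all (fun c : {set T} => x \notin c) p ->
    spread p (B :|: [set x]) = spread p B :|: [set x].
  by move=> xp; rewrite spreadU spread_alone.
have stepx (B : {set T}) y : y \in B -> step (B :|: [set x]) [set x; y] = B :|: [set x].
  move=> yB; rewrite /step; case: ifP => // _; apply/setP=> z; rewrite !inE.
  have [->|_] := eqVneq z y; rewrite ?yB ?orbT ?orbF //.
  by case: (z \in B); case: (z == x).
have inQ (B : {set T}) : B \subset P :|: [set x] -> b \in spread p3 B -> b \in spread p3 P.
  move=> /(spreadS p3)/subsetP sub /sub; rewrite addx // !inE (negbTE bx) orbF //.
move=> bs nbs.
have nQ (B : {set T}) : B \subset P :|: [set x] -> b \notin spread p3 B.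
  by move=> /inQ sub; apply: contra nbs.
have y1A : y1 \in A.
  apply: contraTT bs => ny1; apply: nQ.
  rewrite {2}/step disj // ny1 -/P /step disj //.
  case: ifPn => [_|/negPn y2P]; first exact: subsetUl.
  by rewrite subUset subsetUl subUset !sub1set !inE eqxx y2P orbT.
have stepA : step A [set x; y1] = A :|: [set x].
  rewrite /step disj // y1A; apply/setP=> z; rewrite !inE.
  by have [->|] := eqVneq z y1; rewrite ?y1A ?orbT ?orbF.
rewrite stepA addx // -/P in bs *.
have y2P : y2 \notin P.
  apply: contraTN bs => y2P; apply: nQ; by rewrite stepx.
split=> //.
- by rewrite !inE negb_or y2P eq_sym.
- move: bs; rewrite /step; case: ifPn => [_ bs|_].
    by move: bs; rewrite addx // !inE (negbTE bx) orbF (negbTE nbs).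
  rewrite setUA -(setUA P) setUid spreadU addx // !inE (negbTE bx) (negbTE nbs) //.
have RP : R \subset P by apply: spreadS; rewrite sub1set.
rewrite /step disj // (contra (subsetP RP y2)) //.
by apply: contra nbs; apply: (subsetP (spreadS p3 RP)).
Qed.

End Sequences.

(** * The upper bound *)

Section Bound.
Variable T : finType.
Implicit Types (V : {set T}) (s : seq {set T}).

Definition unaware V s := [set p in setX V V | p.2 \notin spread s [set p.1]].

Lemma card_unaware V s : calls V s -> #|unaware V s| + tot V s = #|V| * #|V|.
Proof.
move=> sV; have -> : #|unaware V s| = \sum_(x in V) #|V :\: spread s [set x]|.
  rewrite -sum1_card (eq_bigr (fun x => \sum_(z in V :\: spread s [set x]) 1)).
    rewrite pair_big_dep /=; apply: eq_bigl => -[x z].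
    by rewrite !inE /= -andbA [X in _ && X]andbC.
  by move=> x _; rewrite sum1_card.
rewrite -big_split /= -sum_nat_const; apply: eq_bigr => x xV.
have := cardsID (spread s [set x]) V.
by rewrite (setIidPr (calls_spread sV xV)) addnC.
Qed.

Lemma split_two m s (i1 i2 : 'I_m) : size s = m -> i1 < i2 ->
  s = take i1 s ++ nth set0 s i1 ::
        take (i2 - i1.+1) (drop i1.+1 s) ++ nth set0 s i2 :: drop i2.+1 s /\
  take i2 s = take i1 s ++ nth set0 s i1 :: take (i2 - i1.+1) (drop i1.+1 s).
Proof.
move=> sm i12; have lt1 : i1 < size s by rewrite sm.
have lt2 : i2 < size s by rewrite sm.
have E2 : take i2 s = take i1 s ++ nth set0 s i1 :: take (i2 - i1.+1) (drop i1.+1 s).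
  rewrite -{1}(cat_take_drop i1 s) take_cat size_take lt1 ltnNge ltnW //=.
  rewrite (drop_nth set0 lt1); congr (_ ++ _).
  by have -> : i2 - i1 = (i2 - i1.+1).+1 by rewrite subnSK.
split=> //; rewrite -cat_cons catA -E2 -(drop_nth set0 lt2) cat_take_drop //.
Qed.

(** Without [x] and her two calls at least three pairs are missing. Each was missing before, away
    from [x], or relied on the route over [y1], [x], [y2]; the product bounds the number of the
    latter. *)
Lemma seq_history_deletable V m s (sm : size s = m) (sV : calls V s) (ns : noho_seq s) :
    m + 5 = 2 * #|V| -> 4 < #|V| ->
    (forall V' s', #|V'| + 1 = #|V| -> calls V' s' -> size s' + 5 = 2 * #|V'| ->
       tot V' s' + 3 <= #|V'| * #|V'|) ->
  deletable (seq_history sm sV ns).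
Proof.
set h := seq_history sm sV ns => m5 n5 IH x i1 y1 i2 y2 tc.
have xV := two_callsV tc; have [i12 E1 E2 [n1 n2] cs] := tc.
have lt12 : i1 < i2 := i12.
have [sE s2E] := split_two sm lt12.
set p1 := take i1 s in sE s2E; set p2 := take _ _ in sE s2E; set p3 := drop _ _ in sE.
have E1' : nth set0 s i1 = [set x; y1] := E1.
have E2' : nth set0 s i2 = [set x; y2] := E2.
rewrite E1' E2' in sE; rewrite E1' in s2E.
have only i : i < m -> x \in nth set0 s i -> i = i1 \/ i = i2.
  move=> lt_i xi; have : Ordinal lt_i \in [set i1; i2] by rewrite -cs inE.
  by rewrite !inE => /pred2P[]<-; [left | right].
have d1 : drop i1.+1 s = p2 ++ [set x; y2] :: p3.
  rewrite sE -cat_rcons drop_size_cat // size_rcons size_take sm.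
  by have := ltn_ord i1 => ->.
have szp1 : size p1 = i1 by rewrite size_take sm ltn_ord.
have nox : all (fun c : {set T} => x \notin c) (p1 ++ p2 ++ p3).
  rewrite !all_cat; apply/and3P; split; apply/(all_nthP set0) => i lt_i; apply/negP.
  - rewrite szp1 in lt_i; rewrite nth_take // => xi.
    by have [] := only i (ltn_trans lt_i (ltn_ord i1)) xi; move: lt_i lt12; lia.
  - move: lt_i; rewrite size_take size_drop sm => lt_i.
    have lt_i' : i < i2 - i1.+1 by move: lt_i; case: ifP => // + lt_i; lia.
    rewrite nth_take // nth_drop => xi.
    have lt_m : i1.+1 + i < m by move: lt_i' (ltn_ord i2) lt12; clear; lia.
    by have [] := only _ lt_m xi; move: lt_i' lt12; clear; lia.
  rewrite size_drop sm in lt_i; rewrite nth_drop => xi.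
  have lt_m : i2.+1 + i < m by move: lt_i; clear; lia.
  by have [] := only _ lt_m xi; move: lt12; clear; lia.
set s' := p1 ++ p2 ++ p3 in nox.
have s'V : calls (V :\ x) s'.
  apply/allP=> c cs'; have cs0 : c \in s.
    move: cs'; rewrite sE !(mem_cat, inE).
    by case/or3P=> ->; rewrite ?orbT.
  have /andP[-> cV] := allP sV c cs0.
  by rewrite subsetD1 cV (allP nox).
have V1 : #|V :\ x| + 1 = #|V| by rewrite [in RHS](cardsD1 x) xV addnC.
have sz' : size s' + 2 = m.
  by rewrite -sm [in RHS]sE /s' !size_cat /= size_cat /=; clear; lia.
have un3 : 3 <= #|unaware (V :\ x) s'|.
  have := card_unaware s'V; have := IH _ _ V1 s'V.
  have -> : size s' + 5 = 2 * #|V :\ x| by move: sz' m5 V1; clear; lia.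
  by move/(_ erefl); clear; lia.
have sub : unaware (V :\ x) s' \subset (missing h :\: missing_at h x) :|:
    setX (known h i1 y1 :\: known h i2 y2) (fed h i2 y2 :\: fed h i1 y1).
  apply/subsetP=> -[a b] /setIdP[/setXP[/setD1P[ax aV] /setD1P[bx bV]] /= nab'].
  have [nab|ab] := boolP ((a, b) \in missing h).
    rewrite in_setU in_setD nab andbT.
    by rewrite /missing_at in_set nab /= (negbTE ax) (negbTE bx).
  have {}ab : b \in spread s [set a] by move: ab; rewrite in_missing aV bV negbK.
  rewrite sE in ab.
  have [y1a y2a by2 by1] := spread_two_calls_deleted nox ax bx n1 n2 ab nab'.
  rewrite in_setU in_setX !in_setD; apply/orP; right.
  have -> : a \in known h i1 y1 by rewrite in_set aV.
  have -> : b \in fed h i2 y2.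
    by rewrite in_set bV; change (y2 \in spread (rev p3) [set b]); rewrite -in_spread_rev.
  rewrite !andbT; apply/andP; split; rewrite in_set ?aV ?bV /=.
    by change (y2 \notin spread (take i2 s) [set a]); rewrite s2E.
  change (y1 \notin spread (rev (drop i1.+1 s)) [set b]).
  by rewrite d1 -in_spread_rev.
have := leq_trans (subset_leq_card sub) (leq_card_setU _ _); rewrite cardsX.
have := cardsID (missing_at h x) (missing h).
rewrite (setIidPr (missing_at_sub h x)).
by move: un3; clear; lia.
Qed.

Theorem tot_upper_bound V s r : calls V s -> #|V| <= size s + 1 ->
  size s + r + 3 = 2 * #|V| -> 2 <= r ->
  2 * tot V s + r * (r + 1) <= 2 * (#|V| * #|V|).
Proof.
elim: {V}#|V| {-2}V (erefl #|V|) s r => [|n IHn] V Vn s r sV.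
  by rewrite Vn; clear; lia.
rewrite Vn => le_n sr r2.
have quad := tot_le_quadratic V (calls_card2 sV); rewrite Vn in quad.
(* When the calls are one fewer than the people, the quadratic bound is exactly the claim. *)
have [eq_n|lt_n] := eqVneq (size s + 1) n.+1.
  have -> : r = n.-1 by move: eq_n sr; clear; lia.
  have sn : size s = n by move: eq_n; clear; lia.
  rewrite sn in quad; move: quad sr r2; rewrite sn; case: (n) => [|k] /=; first lia.
  by clear; nia.
have {}lt_n : n.+1 <= size s by move: le_n lt_n; clear; lia.
have [ns|ho] := boolP (noho_seq s).
  pose h := seq_history erefl sV ns.
  have hE : missing h = unaware V s by [].
  have DE := card_unaware sV; rewrite Vn in DE.
  have [r3|r3] := ltnP 2 r.
    (* With [N] people this bounds twice the number of missing pairs below by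
       [r * (r + 1) + (r - 3) * (N - r - 2)], and [N >= r + 2]. *)
    have := missing_lower_bound h; rewrite hE Vn.
    move: DE sr lt_n r3; move: #|unaware V s| (tot V s) (size s) => D t k; clear.
    nia.
  have rE : r = 2 by apply/eqP; rewrite eqn_leq r3.
  have del : deletable h.
    apply: seq_history_deletable; rewrite ?Vn.
    - by move: sr rE; clear; lia.
    - by move: sr rE lt_n; clear; lia.
    move=> V' s' V'n s'V sz'; have {}V'n : #|V'| = n by move: V'n; clear; lia.
    have := IHn V' V'n s' 2 s'V; rewrite V'n.
    rewrite V'n in sz'; move: sz' sr rE lt_n; clear; lia.
  have : 2 < #|missing h|.
    by apply: missing_ge3 => //; rewrite Vn; move: sr rE lt_n; clear; lia.
  by rewrite hE rE; move: DE; clear; lia.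
move: ho; rewrite /noho_seq negb_forall => /existsP[t]; rewrite negb_forall.
case/existsP=> x; rewrite negb_forall => /existsP[z]; rewrite !negb_imply.
case/and3P=> zk xf zx.
have xV : x \in V.
  have [|u [c [w [p [E xc _ _ _]]]]] := spread_enter xf; first by rewrite inE eq_sym.
  have cs : c \in s by rewrite -(cat_take_drop t s) E !mem_cat inE eqxx !orbT.
  by have /andP[_ /subsetP] := allP sV c cs; apply.
have sV' : calls V (take t s ++ drop t s) by rewrite cat_take_drop.
have [s' [s'V sz' tot']] := hears_own_reduction sV' xV zx zk xf.
rewrite cat_take_drop Vn in sz' tot'.
have Vn' : #|V :\ x| = n by have := cardsD1 x V; rewrite xV Vn; clear; lia.
(* The parameter of the shorter sequence is at least [r]. If it has too few calls for the induction
   hypothesis, the quadratic bound suffices. *)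
have [le_s'|lt_s'] := leqP n (size s' + 1).
  have := IHn _ Vn' s' (2 * n - 3 - size s') s'V; rewrite Vn' le_s'.
  move/(_ isT) => IH.
  have r' : r <= 2 * n - 3 - size s' by move: sr sz'; clear; lia.
  have : 2 * tot (V :\ x) s' + r * (r + 1) <= 2 * (n * n).
    apply: leq_trans (IH _ _); last 2 first.
    - by move: sr sz' r2; clear; lia.
    - by apply: leq_trans r2 r'.
    by rewrite leq_add2l leq_mul // leq_add2r.
  by move: tot'; clear; nia.
have := tot_le_quadratic (V :\ x) (calls_card2 s'V); rewrite Vn'.
move: tot' lt_s' sr lt_n; move: (tot _ _) (tot _ _) (size s') (size s) => t1 t2 k l.
by clear; nia.
Qed.

End Bound.

(** * The star *)

Section Star.
Variable n : nat.
Implicit Types (s : seq {set 'I_n}) (u v x : 'I_n).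

Lemma in_final_knowledge s v x : (x \in final_knowledge s v) = (v \in spread s [set x]).
Proof.
elim/last_ind: s v => [|s c IHs] v; first by rewrite !inE eq_sym.
rewrite spread_rcons in_step -IHs /final_knowledge -cats1 foldl_cat /= /make_call.
case: ifP => vc; last by rewrite orbF.
apply/bigcupP/idP => [[u uc]|].
  rewrite IHs => us; apply/orP; right; apply/meetP; by exists u.
case/orP=> [xv|/meetP[u us uc]]; first by exists v.
by exists u; rewrite // IHs.
Qed.

(** [total_known] counts by person and [tot] by item; time reversal exchanges the two. *)
Lemma total_known_tot s : total_known s = tot [set: 'I_n] (rev s).
Proof.
rewrite /total_known /tot; apply: eq_big => [v|v _]; first by rewrite inE.
by apply: eq_card => x; rewrite in_final_knowledge in_spread_rev.
Qed.

Lemma is_call_calls s : all (@is_call n) s -> calls [set: 'I_n] (rev s).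
Proof.
move=> sc; rewrite /calls all_rev; apply: sub_all sc => c.
by rewrite /is_call subsetT andbT.
Qed.

Lemma card_vpair a b : 0 < a <= n -> 0 < b <= n -> a != b -> #|vpair n a b| = 2.
Proof.
case: a b => [|a] [|b] //= an bn ab.
rewrite (_ : vpair n a.+1 b.+1 = [set Ordinal an; Ordinal bn]).
  by rewrite cards2 -val_eqE /=; rewrite eqSS in ab; rewrite ab.
by apply/setP=> i; rewrite !inE -!val_eqE /= !eqSS.
Qed.

Lemma size_star : size (star_calls n) = n.-1 + n.-2.
Proof. by rewrite size_cat !size_map !size_iota; lia. Qed.

Lemma nth_star k : k < n.-1 + n.-2 -> nth set0 (star_calls n) k =
  if k < n.-1 then vpair n k.+2 1 else vpair n 1 (k - n.-1).+2.
Proof.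
move=> lt_k; rewrite nth_cat size_map size_iota.
have -> : n.+1 - 2 = n.-1 by lia.
case: ifP => kn; rewrite (nth_map 0) ?size_iota ?nth_iota ?add2n //; lia.
Qed.

Lemma star_is_call m : m + 3 <= 2 * n -> call_sequence m (take m (star_calls n)).
Proof.
move=> hm; apply/andP; split.
  by rewrite size_take size_star; apply/eqP; case: ltnP; lia.
have: all (@is_call n) (star_calls n); last first.
  by apply: contraTT; rewrite -[in X in _ -> X](cat_take_drop m (star_calls n)) all_cat => /negbTE->.
apply/(all_nthP set0) => k; rewrite size_star => lt_k; rewrite nth_star // /is_call.
by case: ifP => kn; rewrite card_vpair //; lia.
Qed.

Definition down_to k : {set 'I_n} := [set u : 'I_n | u <= k].

Lemma card_down_to k : k < n -> #|down_to k| = k.+1.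
Proof.
move=> kn; have inj : injective (widen_ord kn).
  by move=> i j ij; apply: val_inj; apply: (congr1 (@nat_of_ord n) ij).
rewrite -[RHS]card_ord -(card_imset predT inj).
apply: eq_card => u; rewrite !inE; apply/idP/imsetP => [uk|[i _ ->]]; last exact: (ltn_ord i).
by exists (Ordinal (uk : u < k.+1)) => //; apply: val_inj.
Qed.

Lemma final_knowledge_rcons s c v : final_knowledge (rcons s c) v =
  if v \in c then \bigcup_(u in c) final_knowledge s u else final_knowledge s v.
Proof. by rewrite /final_knowledge -cats1 foldl_cat. Qed.

(** The star after [k < n] calls, the hub being person 0: a spoke [v] that has called holds what the
    hub had collected by then. *)
Definition gathered k v : {set 'I_n} :=
  if v == 0 :> nat then down_to k else if v <= k then down_to v else [set v].

Lemma star_gather k v : k < n ->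
  gathered k v \subset final_knowledge (take k (star_calls n)) v.
Proof.
elim: k v => [|k IHk] v kn.
  rewrite take0 /gathered /final_knowledge /= /init_knowledge.
  case: eqP => [v0|v0]; last by case: ifP => //; case: (v : nat) v0.
  by apply/subsetP=> u; rewrite !inE -val_eqE /= v0 leqn0.
have lt_k : k < n.-1 + n.-2 by lia.
rewrite (take_nth set0) ?size_star // nth_star // (_ : k < n.-1); last lia.
rewrite final_knowledge_rcons; case: ifP => vc; last first.
  apply: subset_trans (IHk v (ltnW kn)); move/negbT: vc.
  rewrite !inE !eqSS => /norP[vk v0]; rewrite /gathered (negbTE v0).
  by have -> : (v <= k.+1) = (v <= k) by lia.
have sub : gathered k.+1 v \subset down_to k.+1.
  move: vc; rewrite !inE /gathered !eqSS => /orP[/eqP vk|-> //].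
  by rewrite vk /= leqnn.
apply: subset_trans sub _; apply/subsetP=> u; rewrite inE => uk; apply/bigcupP.
have n0 : 0 < n by lia.
have [uk'|uk'] := leqP u k.
  exists (Ordinal n0); first by rewrite !inE orbT.
  by apply: (subsetP (IHk _ (ltnW kn))); rewrite /gathered /= inE.
exists u; first by rewrite !inE !eqSS (_ : u == k.+1 :> nat) //; lia.
apply: (subsetP (IHk _ (ltnW kn))); rewrite /gathered (_ : u == 0 :> nat = false); last lia.
by rewrite leqNgt uk' inE.
Qed.

(** In the second round the hub, now knowing everything, informs [1, ..., t]; the others keep what
    they got in the first round. *)
Lemma star_broadcast t v : t + 2 <= n ->
  (if v <= t then setT else down_to v) \subset
    final_knowledge (take (n.-1 + t) (star_calls n)) v.
Proof.
move=> tn; elim: t v tn => [|t IHt] v tn.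
  rewrite addn0; apply: subset_trans (star_gather v _); last lia.
  rewrite /gathered leqn0; have := ltn_ord v; case: eqP => [v0 vn|_ vn].
    by apply/subsetP=> u _; rewrite inE; have := ltn_ord u; lia.
  by rewrite (_ : v <= n.-1) //; lia.
have lt_k : n.-1 + t < n.-1 + n.-2 by lia.
rewrite addnS (take_nth set0) ?size_star // nth_star // ltnNge leq_addr addKn /=.
have tn' : t + 2 <= n by lia.
rewrite final_knowledge_rcons; have [vc|] := boolP (v \in vpair n 1 t.+2); last first.
  rewrite !inE !eqSS => /norP[v0 vt]; apply: subset_trans (IHt v tn').
  by have -> : (v <= t.+1) = (v <= t) by lia.
apply: subset_trans (subsetT _) _; have n0 : 0 < n by lia.
apply: subset_trans (IHt (Ordinal n0) tn') _.
by apply: bigcup_sup; rewrite !inE.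
Qed.

Lemma sum_gathered k : k < n -> 2 * n + k * (k + 3) <=
  2 * total_known (take k (star_calls n)).
Proof.
move=> kn; have le : \sum_(v < n) (if v == 0 :> nat then k.+1 else if v <= k then v.+1 else 1)
    <= total_known (take k (star_calls n)).
  apply: leq_sum => v _; apply: leq_trans (subset_leq_card (star_gather v kn)).
  rewrite /gathered; case: ifP => _; first by rewrite card_down_to.
  by case: ifP => _; rewrite ?card_down_to ?cards1.
apply: leq_trans (leq_mul (leqnn 2) le); rewrite -(big_mkord xpredT
  (fun i => if i == 0 then k.+1 else if i <= k then i.+1 else 1)).
rewrite (big_cat_nat _ (n := k.+1)) //= [X in 2 * (_ + X)](eq_big_nat _ _ (F2 := fun=> 1)); last first.
  by move=> i /andP[ki _]; rewrite leqNgt ki; case: i ki.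
rewrite sum_nat_const_nat (eq_big_nat _ _ (F2 := fun i => if i == 0 then k.+1 else i.+1)); last first.
  by move=> v /andP[_ vk]; rewrite -ltnS vk.
have E a j : 2 * \sum_(0 <= i < j.+1) (if i == 0 then a else i.+1) = 2 * a + j * (j + 3).
  elim: j => [|j IHj]; first by rewrite big_nat1 /= mul0n addn0.
  by rewrite big_nat_recr //= mulnDr IHj; clear; lia.
by have := E k.+1 k; move: kn; clear; lia.
Qed.

(** A person [v > t] lacks at most [n - 1 - v] items, and these numbers run from [r] down to 0. *)
Lemma sum_broadcast t r : t + 2 <= n -> r + t + 2 = n ->
  2 * (n * n) <= 2 * total_known (take (n.-1 + t) (star_calls n)) + r * (r + 1).
Proof.
move=> tn rt; have le : \sum_(v < n) (if v <= t then n else v.+1)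
    <= total_known (take (n.-1 + t) (star_calls n)).
  apply: leq_sum => v _; apply: leq_trans (subset_leq_card (star_broadcast v tn)).
  by case: ifP => _; rewrite ?card_down_to ?cardsT ?card_ord.
suff : 2 * \sum_(v < n) (if v <= t then n else v.+1) + r * (r + 1) = 2 * (n * n).
  by move: le; clear; lia.
rewrite -(big_mkord xpredT (fun i => if i <= t then n else i.+1)).
have E a d : 2 * (\sum_(0 <= i < t.+1 + d) (if i <= t then a else i.+1)) + t.+1 * t.+2
    = 2 * t.+1 * a + (t.+1 + d) * (t.+1 + d).+1.
  elim: d => [|d IHd].
    rewrite addn0 (eq_big_nat _ _ (F2 := fun=> a)); last by move=> v /andP[_]; rewrite ltnS => ->.
    by rewrite sum_nat_const_nat; clear; lia.
  rewrite addnS big_nat_recr //= (_ : (t.+1 + d <= t) = false); last by clear; lia.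
  by move: IHd; clear; lia.
have := E n r.+1; have -> : t.+1 + r.+1 = n by move: rt; clear; lia.
by move: rt; clear; nia.
Qed.

End Star.

Theorem theorem1 (n m : nat) (hm : m + 5 <= 2 * n) :
  call_sequence m (take m (star_calls n)) /\
  (forall s : seq {set 'I_n},
     call_sequence m s ->
     total_known s <= total_known (take m (star_calls n))).
Proof.
split; first by apply: star_is_call; lia.
move=> s /andP[/eqP sm /is_call_calls sV].
rewrite total_known_tot -(leq_pmul2l (isT : 0 < 2)).
have szr : size (rev s) = m by rewrite size_rev.
have Vn : #|[set: 'I_n]| = n by rewrite cardsT card_ord.
(* Up to [m = n - 1] the star attains the quadratic bound; beyond, the comparison is through
   [r = 2 * n - 3 - m]. *)
have [mn|nm] := ltnP m n.
  apply: leq_trans (sum_gathered mn).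
  by have := tot_le_quadratic [set: 'I_n] (calls_card2 sV); rewrite szr Vn.
have := @tot_upper_bound _ _ _ (2 * n - 3 - m) sV; rewrite szr Vn.
have := @sum_broadcast n (m - n.-1) (2 * n - 3 - m).
have -> : n.-1 + (m - n.-1) = m by lia.
by move: hm nm; clear; lia.
Qed.
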